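(* Let $1\le p<\infty$, $n\in\mathbb N$, $F\in L^p$, and $f=F^{(n)}\in L^{(n),p}$. Let $\Phi_y(x)=\frac{y}{\pi}(x^2+y^2)^{-1}$ and $U_y(x)=\Phi_y\ast F(x)=\frac{y}{\pi}\int_{-\infty}^\infty F(\xi)[(x-\xi)^2+y^2]^{-1}\,d\xi$ for $(x,y)\in\Pi^+=\{(x,y): y>0\}$. Then: (a) for each $(x,y)\in\Pi^+$, the Poisson integral $u_y(x)=\Phi_y\ast f(x):=(-1)^n\int_{-\infty}^\infty F(\xi)\,\frac{\partial^n}{\partial\xi^n}\Phi_y(\xi-x)\,d\xi$ is well defined (as a Lebesgue integral) and equals $\frac{\partial^n}{\partial x^n}U_y(x)$; (b) $(x,y)\mapsto u_y(x)$ is harmonic in $\Pi^+$; (c) for each $y>0$, $u_y\in L^{(n),p}$ (with primitive $U_y$) and $\|u_y\|^{(n)}_p\le\|f\|^{(n)}_p$; (d) $\|u_y-f\|^{(n)}_p\to0$ as $y\to0^+$.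
   Context: $D^n$ or $F^{(n)}$ denotes the $n$th distributional derivative on $\mathcal S'$. For $1\le p<\infty$, $L^{(n),p}=\{f\in\mathcal S' : f=D^nF \text{ for some } F\in L^p(\mathbb R)\}$; such $F$ is unique (the primitive), linear operations are defined through primitives, and $\|f\|^{(n)}_p:=\|F\|_p$. *)

(* Defs.v *)
From HB Require Import structures.
From mathcomp Require Import all_boot all_order all_algebra.
From mathcomp Require Import all_classical all_reals all_analysis.
Set Implicit Arguments. Unset Strict Implicit. Unset Printing Implicit Defensive.
Import Order.TTheory GRing.Theory Num.Theory.
Import numFieldNormedType.Exports.
Local Open Scope classical_set_scope.
Local Open Scope ring_scope.

Section Defs.
Variable R : realType.

Local Notation mu := (@lebesgue_measure R).

(* F is in L^p(R) (Borel-measurable representative), 1 <= p < oo *)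
Definition inLp (p : R) (F : R -> R) : Prop :=
  measurable_fun setT F /\
  (\int[mu]_x ((`|F x| `^ p)%:E) < +oo)%E.

Definition Lpnorm (p : R) (F : R -> R) : \bar R :=
  Lnorm mu p%:E (EFin \o F).

Definition schwartz (phi : R -> R) : Prop :=
  (forall j x, derivable (derive1n j phi) x 1) /\
  (forall j k : nat, exists M : R, forall x, `|x| ^+ k * `|derive1n j phi x| <= M).

(* "u = D^n G in S'": the function u defines a tempered distribution
   (u * phi integrable for every Schwartz phi) equal to the n-th
   distributional derivative of G. *)
Definition is_nth_distr_deriv (n : nat) (u G : R -> R) : Prop :=
  forall phi, schwartz phi ->
    mu.-integrable setT (EFin \o (fun x => u x * phi x)) /\
    Rintegral mu setT (fun x => u x * phi x) =
      (-1) ^+ n * Rintegral mu setT (fun x => G x * derive1n n phi x).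

Definition poisson (y x : R) : R := y / (pi * (x ^+ 2 + y ^+ 2)).

Definition poissonU (F : R -> R) (y x : R) : R :=
  Rintegral mu setT (fun xi => F xi * poisson y (x - xi)).

Definition poisson_integrand (n : nat) (F : R -> R) (y x : R) : R -> R :=
  fun xi => F xi * derive1n n (fun t => poisson y (t - x)) xi.

Definition poissonu (n : nat) (F : R -> R) (y x : R) : R :=
  (-1) ^+ n * Rintegral mu setT (poisson_integrand n F y x).

Definition pdx (w : R * R -> R) : R * R -> R :=
  fun z => derive1 (fun t => w (t, z.2)) z.1.
Definition pdy (w : R * R -> R) : R * R -> R :=
  fun z => derive1 (fun t => w (z.1, t)) z.2.
Definition has_pdx (w : R * R -> R) (z : R * R) : Prop :=
  derivable (fun t => w (t, z.2)) z.1 1.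
Definition has_pdy (w : R * R -> R) (z : R * R) : Prop :=
  derivable (fun t => w (z.1, t)) z.2 1.

Definition C2_on (D : set (R * R)) (w : R * R -> R) : Prop :=
  forall z, D z ->
    (has_pdx w z /\ has_pdy w z /\
     has_pdx (pdx w) z /\ has_pdy (pdx w) z /\
     has_pdx (pdy w) z /\ has_pdy (pdy w) z) /\
    ({for z, continuous w} /\
     {for z, continuous (pdx w)} /\ {for z, continuous (pdy w)} /\
     {for z, continuous (pdx (pdx w))} /\ {for z, continuous (pdy (pdx w))} /\
     {for z, continuous (pdx (pdy w))} /\ {for z, continuous (pdy (pdy w))}).

Definition harmonic_on (D : set (R * R)) (w : R * R -> R) : Prop :=
  open D /\ C2_on D w /\
  forall z, D z -> pdx (pdx w) z + pdy (pdy w) z = 0.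

Definition upper_half_plane : set (R * R) := [set z | 0 < z.2].

End Defs.

(* Main.v *)
(** The Poisson kernel is [- 1/pi] times the imaginary part of [(t + i y)^-1],
    and differentiation in [t] or [y] permutes, up to constants, the real and
    imaginary parts of the powers [(t + i y)^-m].  For [m > 0] all of these,
    except [Re (t + i y)^-1], are [O(1 / (1 + t^2))] locally uniformly in
    [y > 0], and [|F(xi)| / (1 + xi^2)] is integrable for [F] in [L^p].
    Differentiating under the integral sign gives (a); (b) follows since the
    two second derivatives of [(t + i y)^-m] cancel.

    Jensen's inequality for the probability density [Phi_y] and Tonelli's
    theorem give, for every measurable [g],
      [int |U_y - g|^p <= int Phi_y(s) (int |F(x - s) - g(x)|^p dx) ds].
    For [g = 0] this is the contraction in (c); for [g = F] it yields (d),
    because translation is continuous in [L^p] and the mass of [Phi_y]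
    concentrates at [0].  The derivatives of [U_y] grow at most like [1 + x^2],
    so integrating by parts against Schwartz functions leaves no boundary terms,
    and [u_y] is the [n]-th distributional derivative of [U_y]. *)
Require Import Defs.
From HB Require Import structures.
From mathcomp Require Import all_boot all_order all_algebra.
From mathcomp Require Import all_classical all_reals all_analysis.
From mathcomp Require Import measurable_realfun ring lra complex.
Set Implicit Arguments. Unset Strict Implicit. Unset Printing Implicit Defensive.
Import Order.TTheory GRing.Theory Num.Theory.
Import numFieldNormedType.Exports.
Import complex ComplexField.Normc.
Local Open Scope classical_set_scope.
Local Open Scope ring_scope.

(** * Calculus on the real line *)

Section integrable_real.
Context d (T : measurableType d) (R : realType) (mu : {measure set T -> \bar R}).
Implicit Types f g : T -> R.

Lemma integrable_EFinZl f (k : R) : mu.-integrable setT (EFin \o f) ->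
  mu.-integrable setT (EFin \o (fun x => k * f x)).
Proof. by move=> /(integrableZl measurableT k); congr integrable. Qed.

Lemma integrable_EFinD f g : mu.-integrable setT (EFin \o f) ->
  mu.-integrable setT (EFin \o g) ->
  mu.-integrable setT (EFin \o (fun x => f x + g x)).
Proof. by move=> fi /(integrableD measurableT fi); congr integrable. Qed.

Lemma le_integrable_EFin f g : measurable_fun setT f ->
  (forall x, `|f x| <= g x) -> mu.-integrable setT (EFin \o g) ->
  mu.-integrable setT (EFin \o f).
Proof.
move=> mf fg; apply: le_integrable => //; first exact/measurable_EFinP.
by move=> x _ /=; rewrite lee_fin (le_trans (fg x))// ler_norm.
Qed.

Lemma is_derive_Rintegral (f df : R -> T -> R) (G : T -> R) (a r : R) : 0 < r ->
  (forall u, `|u - a| < r -> mu.-integrable setT (EFin \o f u)) ->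
  (forall u x, `|u - a| < r -> is_derive u 1 (f ^~ x) (df u x)) ->
  (forall u x, `|u - a| < r -> `|df u x| <= G x) ->
  mu.-integrable setT (EFin \o G) ->
  is_derive a 1 (fun u => \int[mu]_x f u x) (\int[mu]_x df a x).
Proof.
move=> r0 fi dfE dfG Gi; pose I : set R := `]a - r, a + r[%classic.
have IE u : I u -> `|u - a| < r by rewrite /I/= in_itv/= ltr_distl.
have aa : `|a - a| < r by rewrite subrr normr0.
have Ia : I a by rewrite /I/= in_itv/= -ltr_distl.
have pd1E u x : I u -> partial1of2 f u x = df u x.
  by move=> /IE ur; rewrite partial1of2E; have [] := dfE u x ur.
have derf u x : I u -> [set: T] x -> derivable (f ^~ x) u 1.
  by move=> /IE ur _; have [] := dfE u x ur.
have G0 x : 0 <= G x by exact: le_trans (dfG a x aa).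
have pd1G u x : I u -> [set: T] x -> `|partial1of2 f u x| <= G x.
  by move=> uI _; rewrite pd1E//; apply: dfG; exact: IE.
have Ifi u : I u -> mu.-integrable setT (EFin \o f u) by move=> /IE; exact: fi.
apply: DeriveDef.
  exact: (derivable_under_integral measurableT Ia Ifi derf G0 Gi pd1G).
rewrite -derive1E.
rewrite (differentiation_under_integral measurableT Ia Ifi derf G0 Gi pd1G).
by apply: eq_Rintegral => x _; exact: pd1E.
Qed.

End integrable_real.

Section real_functions.
Context {R : realType}.

Lemma continuous_shift (f : R -> R) (s : R) : continuous f ->
  continuous (fun x => f (x + s)).
Proof.
move=> cf x; apply: (@continuous_comp _ _ _ (fun v : R => v + s) f).
  by apply: cvgD; [exact: cvg_id|exact: cvg_cst].
exact: cf.
Qed.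

Lemma is_derive_continuous (f : R -> R) (df t : R) : is_derive t 1 f df ->
  {for t, continuous f}.
Proof.
by case=> fd _; apply: differentiable_continuous; exact/derivable1_diffP.
Qed.

Lemma normr_MVT_le (f df : R -> R) (L a c : R) :
  (forall u, `|u - a| <= `|c - a| -> is_derive u 1 f (df u)) ->
  (forall u, `|u - a| <= `|c - a| -> `|df u| <= L) ->
  `|f c - f a| <= L * `|c - a|.
Proof.
move=> dfE dfL.
have MVT_le s t : s <= t -> (forall u, u \in `[s, t] -> `|u - a| <= `|c - a|) ->
    `|f t - f s| <= L * `|t - s|.
  move=> st stE; have [| |u /stE ua ->] := @MVT_segment R f df s t st.
  - by move=> u /subset_itv_oo_cc/stE; exact: dfE.
  - apply: derivable_within_continuous => u /stE ua.
    by have [] := dfE u ua.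
  - by rewrite normrM ler_wpM2r//; exact: dfL.
have [ac|/ltW ca] := leP a c.
  apply: MVT_le => // u; rewrite in_itv/= => /andP[au uc].
  by rewrite !ger0_norm ?subr_ge0// lerD2r.
rewrite distrC [`|c - a|]distrC; apply: MVT_le => // u.
rewrite in_itv/= => /andP[cu ua].
by rewrite distrC [`|c - a|]distrC !ger0_norm ?subr_ge0// lerD2l lerN2.
Qed.

Lemma continuous_bounded_pdx (w : R * R -> R) (z : R * R) (L : R) :
  (\forall v \near z, has_pdx w v /\ `|pdx w v| <= L) ->
  {for z.2, continuous (fun t => w (z.1, t))} -> {for z, continuous w}.
Proof.
case: z => a b /= [[A B] [/nbhs_ballP[r r0 rA] Bb] AB] cw.
suff wz : w v - w (a, v.2) @[v --> (a, b)] --> 0.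
  suff : (w v - w (a, v.2)) + w (a, v.2) @[v --> (a, b)] --> 0 + w (a, b).
    by rewrite add0r; under eq_fun do rewrite subrK.
  apply: cvgD => //; apply: (@cvg_comp _ _ _ snd (fun t => w (a, t))) cw.
  exact: cvg_snd.
have Lv : L * `|v.1 - a| @[v --> (a, b)] --> 0.
  rewrite -[X in _ --> X](mulr0 L) -(normr0 R) -(subrr a).
  apply: cvgM; first exact: cvg_cst.
  by apply: cvg_norm; apply: cvgB; [exact: cvg_fst|exact: cvg_cst].
apply: norm_cvg0; apply: squeeze_cvgr (cvg_cst 0) Lv; near=> v.
have va : ball a r v.1 by near: v; apply: cvg_fst; exact: nbhsx_ballx.
have vB : B v.2 by near: v; exact: cvg_snd.
have pdx_v u : `|u - a| <= `|v.1 - a| ->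
    has_pdx w (u, v.2) /\ `|pdx w (u, v.2)| <= L.
  move=> uv; apply: (AB (u, v.2)); split => //=; apply: rA.
  by rewrite /ball/= distrC (le_lt_trans uv)// distrC.
rewrite normr_ge0/= [X in w X - _]surjective_pairing.
apply: (@normr_MVT_le (fun t => w (t, v.2)) (fun t => pdx w (t, v.2)) L a v.1).
- move=> u /pdx_v[du _]; apply: DeriveDef => //.
  by rewrite /pdx derive1E.
- by move=> u /pdx_v[].
Unshelve. all: end_near. Qed.

End real_functions.

Section integral_derivative.
Context {R : realType}.
Local Notation mu := (@lebesgue_measure R).
Implicit Types (f g : R -> R) (n : nat).

Lemma integrable_cvg_symmetric_itv f : mu.-integrable setT (EFin \o f) ->
  \int[mu]_(x in `[- n%:R, n%:R]) f x @[n --> \oo] --> \int[mu]_x f x.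
Proof.
move=> fi; pose f_ n := (EFin \o f) \_ `[- n%:R, n%:R].
have mf : measurable_fun setT (EFin \o f) by case/integrableP: fi.
have mf_ n : measurable_fun setT (f_ n).
  by apply/(measurable_restrictT _ _).1 => //; exact: measurable_funTS.
have f_cvg : {ae mu, forall x, setT x -> f_ ^~ x @ \oo --> (EFin \o f) x}.
  apply: aeW => x _; apply: cvg_near_cst; near=> n.
  rewrite /f_ patchE mem_set//= in_itv/= -ler_norml.
  by near: n; exact: nbhs_infty_ger.
have f_le : {ae mu, forall x n, setT x -> (`|f_ n x| <= `|(EFin \o f) x|)%E}.
  by apply: aeW => x n _; rewrite /f_ patchE; case: ifPn; rewrite // abse0.
have [_ _] := @dominated_convergence _ _ R mu setT measurableT f_ (EFin \o f) _
  mf_ mf f_cvg (integrable_abse fi) f_le.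
under eq_fun do rewrite -integral_mkcond.
rewrite -[X in _ --> X -> _]fineK; last exact: integrable_fin_num.
exact: fine_cvg.
Unshelve. all: end_near. Qed.

Lemma Rintegral_is_derive g (dg : R -> R) (a b : R) :
  (forall x : R, is_derive x 1 g (dg x)) -> continuous dg ->
  mu.-integrable setT (EFin \o dg) ->
  g x @[x --> -oo] --> a -> g x @[x --> +oo] --> b ->
  \int[mu]_x dg x = b - a.
Proof.
move=> gdg cdg dgi ga gb.
apply: (cvg_unique _ (integrable_cvg_symmetric_itv dgi)) => //.
have cg x : {for x, continuous g} by exact: is_derive_continuous (gdg x).
suff : g n%:R - g (- n%:R) @[n --> \oo] --> b - a.
  apply: cvg_trans; apply: near_eq_cvg; near=> n.
  rewrite /Rintegral (@continuous_FTC2 _ dg g) -?EFinB//.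
  - by rewrite gt0_cp// ltr0n; near: n; exact: nbhs_infty_gt.
  - by apply: continuous_subspaceT => x; exact: cdg.
  - split; [by move=> x _; have [] := gdg x| |].
      by apply: cvg_at_right_filter; exact: cg.
    by apply: cvg_at_left_filter; exact: cg.
  - by move=> x _; rewrite derive1E; have [] := gdg x.
apply: cvgB; first exact: (cvg_comp _ _ (@cvgr_idn R) gb).
by apply: cvg_comp ga; apply/cvgNrNy; exact: cvgr_idn.
Unshelve. all: end_near. Qed.

End integral_derivative.

(** * The Cauchy kernel *)

Section complex_derivative.
Context {R : realType}.
Implicit Types (f g : R -> R[i]) (df dg : R[i]) (t : R).

Definition is_cderive t f df :=
  is_derive t 1 (fun u => Re (f u)) (Re df) /\
  is_derive t 1 (fun u => Im (f u)) (Im df).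

Lemma ReM (z w : R[i]) : Re (z * w) = Re z * Re w - Im z * Im w.
Proof. by case: z w => [a b] [c d]. Qed.

Lemma ImM (z w : R[i]) : Im (z * w) = Re z * Im w + Im z * Re w.
Proof. by case: z w => [a b] [c d]. Qed.

Lemma ReV (z : R[i]) : Re z^-1 = Re z / (Re z ^+ 2 + Im z ^+ 2).
Proof. by case: z. Qed.

Lemma ImV (z : R[i]) : Im z^-1 = - Im z / (Re z ^+ 2 + Im z ^+ 2).
Proof. by case: z => a b; rewrite mulNr. Qed.

Lemma is_cderiveM t f g df dg : is_cderive t f df -> is_cderive t g dg ->
  is_cderive t (fun u => f u * g u) (f t * dg + df * g t).
Proof.
move=> [fRe fIm] [gRe gIm]; split.
- under eq_fun do rewrite ReM; apply: is_derive_eq; rewrite /GRing.scale.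
  case: (f t) (g t) df dg {fRe fIm gRe gIm} => [? ?] [? ?] [? ?] [? ?] /=.
  by ring.
- under eq_fun do rewrite ImM; apply: is_derive_eq; rewrite /GRing.scale.
  case: (f t) (g t) df dg {fRe fIm gRe gIm} => [? ?] [? ?] [? ?] [? ?] /=.
  by ring.
Qed.

Lemma is_cderiveV t f df : f t != 0 -> is_cderive t f df ->
  is_cderive t (fun u => (f u)^-1) (- df * (f t)^-1 ^+ 2).
Proof.
move=> ft0 [fRe fIm].
pose q u := Re (f u) ^+ 2 + Im (f u) ^+ 2.
have q0 : q t != 0.
  apply: contra ft0; rewrite paddr_eq0 ?sqr_ge0// !sqrf_eq0.
  by case: (f t) => a b /= /andP[/eqP-> /eqP->].
have dq : is_derive t 1 (fun u => (q u)^-1)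
    (- (q t) ^- 2 * (2 * (Re (f t) * Re df + Im (f t) * Im df))).
  have {}dq : is_derive t 1 q (2 * (Re (f t) * Re df + Im (f t) * Im df)).
    by apply: is_derive_eq; rewrite /GRing.scale/=; ring.
  exact: is_deriveV.
split.
- rewrite (_ : (fun u => _) = fun u => Re (f u) * (q u)^-1); last first.
    by apply/funext => u; rewrite ReV.
  apply: is_derive_eq; rewrite /GRing.scale/= /q in q0 *.
  by case: (f t) df q0 {fRe fIm dq} => [a b] [c d] /= q0; field.
- rewrite (_ : (fun u => _) = fun u => - Im (f u) * (q u)^-1); last first.
    by apply/funext => u; rewrite ImV.
  apply: is_derive_eq; rewrite /GRing.scale/= /q in q0 *.
  by case: (f t) df q0 {fRe fIm dq} => [a b] [c d] /= q0; field.
Qed.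

Lemma is_cderiveX t f df m : is_cderive t f df ->
  is_cderive t (fun u => f u ^+ m) (m%:R * df * f t ^+ m.-1).
Proof.
move=> fdf; elim: m => [|m IHm].
  by rewrite !mul0r; split; exact: is_derive_cst.
under eq_fun do rewrite exprS.
have -> : m.+1%:R * df * f t ^+ m =
    f t * (m%:R * df * f t ^+ m.-1) + df * f t ^+ m.
  by rewrite -natr1; case: m {IHm} => [|m] /=; rewrite ?exprS; ring.
exact: is_cderiveM.
Qed.

Lemma is_cderiveVX t f df m : f t != 0 -> is_cderive t f df ->
  is_cderive t (fun u => (f u)^-1 ^+ m) (- (df * (f t)^-1 ^+ m.+1) *+ m).
Proof.
move=> ft0 /(is_cderiveV ft0)/(is_cderiveX m).
case: m => [|m] /=; first by rewrite !mul0r mulr0n.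
by rewrite -mulr_natl !exprS; congr is_cderive; ring.
Qed.

End complex_derivative.

Section cauchy_kernel.
Context {R : realType}.
Implicit Types (b : bool) (m n : nat) (t x y d M : R) (z : R[i]).

Lemma ReNMn z m : Re (- z *+ m) = - m%:R * Re z.
Proof.
by rewrite (raddfMn (@Re R : Rcomplex R -> R)) mulNr mulr_natl -mulNrn; case: z.
Qed.

Lemma ImNMn z m : Im (- z *+ m) = - m%:R * Im z.
Proof.
by rewrite (raddfMn (@Im R : Rcomplex R -> R)) mulNr mulr_natl -mulNrn; case: z.
Qed.

Lemma normcX z m : normc (z ^+ m) = normc z ^+ m.
Proof. by elim: m => [|m IHm]; rewrite ?expr0 ?normc1// !exprS normcM IHm. Qed.

Lemma normr_Re_le z : `|Re z| <= normc z.
Proof. by case: z => a b; rewrite -sqrtr_sqr ler_wsqrtr// lerDl sqr_ge0. Qed.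

Lemma normr_Im_le z : `|Im z| <= normc z.
Proof. by case: z => a b; rewrite -sqrtr_sqr ler_wsqrtr// lerDr sqr_ge0. Qed.

Lemma upper_complex_neq0 t y : 0 < y -> (t +i* y)%C != 0.
Proof. by move=> y0; rewrite eq_complex negb_and /= orbC gt_eqF. Qed.

Definition cauchy_kernel b m t y : R :=
  (if b then @Re R else @Im R) ((t +i* y)%C^-1 ^+ m).

Lemma is_derive_cauchy_kernel_x b m t y : 0 < y ->
  is_derive t 1 (cauchy_kernel b m ^~ y) (- m%:R * cauchy_kernel b m.+1 t y).
Proof.
move=> y0; have dz : is_cderive t (fun u : R => (u +i* y)%C) 1.
  by split; [exact: is_derive_id|exact: is_derive_cst].
have [dRe dIm] := is_cderiveVX m (upper_complex_neq0 t y0) dz.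
by rewrite /cauchy_kernel; case: b; apply: is_derive_eq;
  rewrite mul1r ?ReNMn ?ImNMn.
Qed.

Lemma is_derive_cauchy_kernel_y b m t y : 0 < y ->
  is_derive y 1 (cauchy_kernel b m t)
    ((-1) ^+ (~~ b) * m%:R * cauchy_kernel (~~ b) m.+1 t y).
Proof.
move=> y0; have dz : is_cderive y (fun u : R => (t +i* u)%C) 'i%C.
  by split; [exact: is_derive_cst|exact: is_derive_id].
have [dRe dIm] := is_cderiveVX m (upper_complex_neq0 t y0) dz.
rewrite /cauchy_kernel; case: b; apply: is_derive_eq; rewrite mulrC.
- by rewrite ReNMn ReiNIm expr0 mul1r mulrNN.
- by rewrite ImNMn ImiRe expr1 mulN1r.
Qed.

Lemma normr_cauchy_kernel_le b m t y :
  `|cauchy_kernel b m t y| <= (normc (t +i* y)%C)^-1 ^+ m.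
Proof.
rewrite -normcV -normcX /cauchy_kernel.
by case: b; [exact: normr_Re_le|exact: normr_Im_le].
Qed.

Lemma oneDsqr_le x y : `|x| <= `|y| -> oneDsqr x <= oneDsqr y.
Proof.
by move=> xy; rewrite lerD2l -[x ^+ 2]real_normK ?num_real//
  -[y ^+ 2]real_normK ?num_real// lerXn2r ?nnegrE.
Qed.

Lemma oneDsqrB_inv_le t x :
  (oneDsqr (t - x))^-1 <= 2 * oneDsqr x / oneDsqr t.
Proof.
rewrite ler_pdivlMr// ler_pdivrMl// /oneDsqr -subr_ge0.
rewrite (_ : _ - _ = 1 + (t - x - x) ^+ 2 + 2 * (x * (t - x)) ^+ 2); last first.
  by ring.
by have := sqr_ge0 (t - x - x); have := sqr_ge0 (x * (t - x)); lra.
Qed.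

Lemma sqrD_sqr_gt0 t y : 0 < y -> 0 < t ^+ 2 + y ^+ 2.
Proof. by move=> y0; rewrite ltr_wpDl ?sqr_ge0// exprn_gt0. Qed.

Lemma inv_sqrD_sqr_le d t y : 0 < d -> d <= y ->
  (t ^+ 2 + y ^+ 2)^-1 <= (1 + d ^- 2) / oneDsqr t.
Proof.
move=> d0 dy; have y0 := lt_le_trans d0 dy.
rewrite ler_pdivlMr// ler_pdivrMl ?sqrD_sqr_gt0//.
apply: (@le_trans _ _ ((t ^+ 2 + d ^+ 2) * (1 + d ^- 2))).
  rewrite /oneDsqr mulrDr mulr1 mulrDl divff ?expf_neq0 ?gt_eqF//.
  have := sqr_ge0 d; have : 0 <= t ^+ 2 / d ^+ 2 by rewrite divr_ge0 ?sqr_ge0.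
  lra.
rewrite ler_wpM2r ?addr_ge0 ?invr_ge0 ?sqr_ge0// lerD2l.
by rewrite ler_sqr ?nnegrE ?(ltW d0) ?(ltW y0).
Qed.

Lemma normr_cauchy_kernel1_le t y :
  `|cauchy_kernel false 1 t y| <= `|y| * (t ^+ 2 + y ^+ 2)^-1.
Proof.
rewrite /cauchy_kernel expr1 ImV/= normrM normrN ler_wpM2l// ger0_norm//.
by rewrite invr_ge0 addr_ge0 ?sqr_ge0.
Qed.

Lemma normr_cauchy_kernelSS_le b m d t y : 0 < d -> d <= y ->
  `|cauchy_kernel b m.+2 t y| <= d^-1 ^+ m * (t ^+ 2 + y ^+ 2)^-1.
Proof.
move=> d0 dy; have y0 := lt_le_trans d0 dy.
apply: le_trans (normr_cauchy_kernel_le _ _ _ _) _.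
rewrite -[m.+2]addn2 exprD [in X in _ * X]exprVn /= sqr_sqrtr; last first.
  by rewrite addr_ge0 ?sqr_ge0.
rewrite ler_wpM2r ?invr_ge0 ?(ltW (sqrD_sqr_gt0 _ y0))//.
apply: lerXn2r; rewrite ?nnegrE ?invr_ge0 ?sqrtr_ge0 ?(ltW d0)//.
rewrite lef_pV2 ?posrE ?sqrtr_gt0 ?sqrD_sqr_gt0//.
rewrite (le_trans dy)// -{1}(ger0_norm (ltW y0)) -sqrtr_sqr ler_wsqrtr//.
by rewrite lerDr sqr_ge0.
Qed.

(* Among the kernels with [0 < m], only the real part of [(t + i y)^-1] decays
   more slowly than [1 / t ^+ 2]; the condition [b < m] excludes it. *)
Lemma cauchy_kernel_bound b m d M : (b < m)%N -> 0 < d ->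
  exists2 C, 0 <= C & forall t y, d <= y <= M ->
    `|cauchy_kernel b m t y| <= C / oneDsqr t.
Proof.
move=> bm d0.
suff [C C0 KC] : exists2 C, 0 <= C & forall t y, d <= y <= M ->
    `|cauchy_kernel b m t y| <= C * (t ^+ 2 + y ^+ 2)^-1.
  exists (C * (1 + d ^- 2)).
    by rewrite mulr_ge0// addr_ge0 ?invr_ge0 ?sqr_ge0.
  move=> t y /[dup] /andP[dy _] /(KC t) /le_trans; apply.
  by rewrite -mulrA ler_wpM2l// inv_sqrD_sqr_le.
case: m bm => [|[|m]] bm; first by case: b bm.
- case: b bm => // _; exists `|M| => // t y /andP[dy yM].
  apply: le_trans (normr_cauchy_kernel1_le _ _) _.
  rewrite ler_wpM2r ?invr_ge0 ?addr_ge0 ?sqr_ge0//.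
  by have y0 := lt_le_trans d0 dy; rewrite gtr0_norm// (le_trans yM) ?ler_norm.
- exists (d^-1 ^+ m); first by rewrite exprn_ge0// invr_ge0 ltW.
  by move=> t y /andP[dy _]; exact: normr_cauchy_kernelSS_le.
Qed.

Lemma cauchy_kernel_shift_bound b m d M : (b < m)%N -> 0 < d ->
  exists2 C, 0 <= C & forall x xi y, d <= y <= M ->
    `|cauchy_kernel b m (xi - x) y| <= C * oneDsqr x / oneDsqr xi.
Proof.
move=> bm d0; have [C C0 KC] := cauchy_kernel_bound M bm d0.
exists (C * 2); first by rewrite mulr_ge0.
move=> x xi y /(KC (xi - x)) /le_trans; apply.
by rewrite -!mulrA ler_wpM2l// mulrA oneDsqrB_inv_le.
Qed.

Lemma continuous_cauchy_kernel b m y : 0 < y ->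
  continuous (cauchy_kernel b m ^~ y).
Proof.
move=> y0 t.
exact: is_derive_continuous (is_derive_cauchy_kernel_x b m t y0).
Qed.

End cauchy_kernel.

Section cauchy_integral.
Context {R : realType}.
Local Notation mu := (@lebesgue_measure R).
Implicit Types (b : bool) (m n : nat) (x y d M : R) (F : R -> R).

Definition weighted_integrable F := measurable_fun setT F /\
  mu.-integrable setT (EFin \o (fun xi => `|F xi| / oneDsqr xi)).

Definition cauchy_integral F b m x y : R :=
  \int[mu]_xi (F xi * cauchy_kernel b m (xi - x) y).

Lemma continuous_cauchy_kernel_shift b m x y : 0 < y ->
  continuous (fun xi => cauchy_kernel b m (xi - x) y).
Proof.
move=> y0; apply: (@continuous_shift _ (cauchy_kernel b m ^~ y)).
exact: continuous_cauchy_kernel.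
Qed.

Lemma integrableM_weighted F (k : R -> R) (C : R) : weighted_integrable F ->
  measurable_fun setT k -> (forall xi, `|k xi| <= C / oneDsqr xi) ->
  mu.-integrable setT (EFin \o (fun xi => F xi * k xi)).
Proof.
move=> [mF wF] mk kC; apply: (le_integrable_EFin _ _ (integrable_EFinZl C wF)).
  exact: measurable_funM.
by move=> xi; rewrite normrM mulrCA ler_wpM2l.
Qed.

Lemma integrable_cauchy_integrand F b m x y : weighted_integrable F ->
  (b < m)%N -> 0 < y ->
  mu.-integrable setT (EFin \o (fun xi => F xi * cauchy_kernel b m (xi - x) y)).
Proof.
move=> wF bm y0; have [C C0 KC] := cauchy_kernel_shift_bound y bm y0.
apply: (@integrableM_weighted _ _ (C * oneDsqr x)) => //.
  by apply: continuous_measurable_fun; exact: continuous_cauchy_kernel_shift.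
by move=> xi; apply: KC; rewrite lexx.
Qed.

Lemma cauchy_integral_bound F b m d M : weighted_integrable F ->
  (b < m)%N -> 0 < d ->
  exists2 C, 0 <= C & forall x y, d <= y <= M ->
    `|cauchy_integral F b m x y| <= C * oneDsqr x.
Proof.
move=> /[dup] wF [mF iF] bm d0.
have [C C0 KC] := cauchy_kernel_shift_bound M bm d0.
pose I := \int[mu]_xi (`|F xi| / oneDsqr xi).
have I0 : 0 <= I by apply: Rintegral_ge0 => xi _; rewrite divr_ge0.
exists (C * I) => [|x y /[dup] dyM /andP[dy _]]; first exact: mulr_ge0.
have iK := integrable_cauchy_integrand x wF bm (lt_le_trans d0 dy).
apply: le_trans (le_normr_Rintegral _ iK) _ => //.
rewrite mulrAC -RintegralZl//; apply: le_Rintegral => //.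
- exact: (integrable_norm iK).
- exact: integrable_EFinZl.
- by move=> xi _; rewrite normrM mulrCA ler_wpM2l// KC.
Qed.

Lemma is_derive_cauchy_integral_x F b m x y : weighted_integrable F ->
  (b < m)%N -> 0 < y ->
  is_derive x 1 (cauchy_integral F b m ^~ y)
    (m%:R * cauchy_integral F b m.+1 x y).
Proof.
move=> /[dup] wF [_ iF] bm y0; have bm1 : (b < m.+1)%N by rewrite ltnW.
have [C C0 KC] := cauchy_kernel_shift_bound y bm1 y0.
rewrite /cauchy_integral -RintegralZl//; last first.
  exact: integrable_cauchy_integrand.
under eq_Rintegral do rewrite mulrCA.
apply: (@is_derive_Rintegral _ _ _ mu _
  (fun u xi => F xi * (m%:R * cauchy_kernel b m.+1 (xi - u) y))
  (fun xi => m%:R * (C * oneDsqr (`|x| + 1)) * (`|F xi| / oneDsqr xi))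
  _ _ ltr01).
- by move=> u _; exact: integrable_cauchy_integrand.
- move=> u xi _; have dshift : is_derive u 1 (fun v : R => xi - v) (-1).
    by apply: is_derive_eq; rewrite add0r mul1r.
  have := @is_derive1_comp R (cauchy_kernel b m ^~ y) (fun v => xi - v) u _ _
    (is_derive_cauchy_kernel_x b m (xi - u) y0) dshift.
  move=> /(is_deriveZ (F xi)) /is_derive_eq; apply.
  by rewrite mulrN1 mulNr opprK.
- move=> u xi ux; rewrite normrM mulrCA ler_wpM2l// normrM ger0_norm// -!mulrA.
  rewrite ler_wpM2l// mulrA (le_trans (KC u xi y _)) ?lexx//.
  rewrite ler_wpM2r ?invr_ge0// ler_wpM2l// oneDsqr_le//.
  rewrite [leRHS]ger0_norm ?addr_ge0//.
  by rewrite -[u](subrK x) addrC (le_trans (ler_normD _ _))// lerD2l ltW.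
- exact: integrable_EFinZl.
Qed.

Lemma is_derive_cauchy_integral_y F b m x y : weighted_integrable F ->
  (b < m)%N -> 0 < y ->
  is_derive y 1 (cauchy_integral F b m x)
    ((-1) ^+ (~~ b) * m%:R * cauchy_integral F (~~ b) m.+1 x y).
Proof.
move=> /[dup] wF [_ iF] bm y0.
have bm1 : (~~ b < m.+1)%N by case: b m bm => -[|[|]].
have y2_gt0 : 0 < y / 2 by rewrite divr_gt0.
have y2_near (u : R) : `|u - y| < y / 2 -> y / 2 <= u <= 2 * y /\ 0 < u.
  by rewrite ltr_norml => /andP[? ?]; split; lra.
have [C C0 KC] := cauchy_kernel_shift_bound (2 * y) bm1 y2_gt0.
set s := _ * m%:R.
rewrite /cauchy_integral -RintegralZl//; last first.
  exact: integrable_cauchy_integrand.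
under eq_Rintegral do rewrite mulrCA.
apply: (@is_derive_Rintegral _ _ _ mu _
  (fun u xi => F xi * (s * cauchy_kernel (~~ b) m.+1 (xi - x) u))
  (fun xi => `|s| * (C * oneDsqr x) * (`|F xi| / oneDsqr xi)) _ _ y2_gt0).
- by move=> u /y2_near[_ u0]; exact: integrable_cauchy_integrand.
- move=> u xi /y2_near[_ u0].
  exact: is_deriveZ (is_derive_cauchy_kernel_y b m (xi - x) u0).
- move=> u xi /y2_near[uy _]; rewrite normrM mulrCA ler_wpM2l// normrM -!mulrA.
  by rewrite ler_wpM2l// mulrA KC.
- exact: integrable_EFinZl.
Qed.

End cauchy_integral.

Section half_plane.
Context {R : realType}.
Implicit Types (b : bool) (m n : nat) (c : R) (z : R * R) (F : R -> R).

Lemma open_upper_half_plane : open (@upper_half_plane R).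
Proof.
rewrite (_ : @upper_half_plane R = snd @^-1` [set t : R | 0 < t])//.
by apply: open_comp => [z _|]; [exact: cvg_snd|exact: open_gt].
Qed.

Lemma near_upper_half_plane z : 0 < z.2 ->
  \forall v \near z, `|v.1| <= `|z.1| + 1 /\ z.2 / 2 <= v.2 <= 2 * z.2.
Proof.
case: z => a c /= c0; near=> v; split.
  apply: ltW; near: v; apply: (cvgr_norm_lt a); first exact: cvg_fst.
  by rewrite ltrDl.
apply/andP; split; near: v.
- by apply: (cvgr_ge c); [exact: cvg_snd|lra].
- by apply: (cvgr_le c); [exact: cvg_snd|lra].
Unshelve. all: end_near. Qed.

Lemma pdx_cauchy_integral F b m z : weighted_integrable F -> (b < m)%N ->
  0 < z.2 ->
  pdx (fun v => cauchy_integral F b m v.1 v.2) z =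
    m%:R * cauchy_integral F b m.+1 z.1 z.2.
Proof.
move=> wF bm z0; rewrite /pdx derive1E.
by have [] := is_derive_cauchy_integral_x z.1 wF bm z0.
Qed.

Lemma continuous_cauchy_integral F b m z : weighted_integrable F ->
  (b < m)%N -> 0 < z.2 ->
  {for z, continuous (fun v : R * R => cauchy_integral F b m v.1 v.2)}.
Proof.
move=> wF bm z0; have z2_gt0 : 0 < z.2 / 2 by rewrite divr_gt0.
have bm1 : (b < m.+1)%N by rewrite ltnW.
have [C C0 CIle] := cauchy_integral_bound (2 * z.2) wF bm1 z2_gt0.
apply: (@continuous_bounded_pdx _ _ _ (m%:R * (C * oneDsqr (`|z.1| + 1)))).
  have := near_upper_half_plane z0; apply: filterS => v [v1 v2].
  have v0 : 0 < v.2 by case/andP: v2 => /(lt_le_trans z2_gt0).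
  split; first by have [] := is_derive_cauchy_integral_x v.1 wF bm v0.
  rewrite pdx_cauchy_integral// normrM ger0_norm// ler_wpM2l//.
  rewrite (le_trans (CIle _ _ v2))// ler_wpM2l// oneDsqr_le//.
  by rewrite [leRHS]ger0_norm ?addr_ge0.
exact: is_derive_continuous (is_derive_cauchy_integral_y z.1 wF bm z0).
Qed.

(* The family [cauchy_integral F] is stable under both partial derivatives, so
   that this lemma also applies to [pdx w] and [pdy w]. *)
Lemma cauchy_integral_partials F b m c (w : R * R -> R) :
  weighted_integrable F -> (b < m)%N ->
  (forall z, 0 < z.2 -> w z = c * cauchy_integral F b m z.1 z.2) ->
  [/\ forall z, 0 < z.2 ->
        [/\ has_pdx w z, has_pdy w z & {for z, continuous w}],
      forall z, 0 < z.2 ->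
        pdx w z = c * m%:R * cauchy_integral F b m.+1 z.1 z.2 &
      forall z, 0 < z.2 -> pdy w z =
        c * ((-1) ^+ (~~ b) * m%:R) * cauchy_integral F (~~ b) m.+1 z.1 z.2].
Proof.
move=> wF bm wE.
have dx z : 0 < z.2 -> is_derive z.1 1 (fun t => w (t, z.2))
    (c * m%:R * cauchy_integral F b m.+1 z.1 z.2).
  move=> z0; rewrite -mulrA.
  rewrite (_ : (fun t => _) = c \*: (fun t => cauchy_integral F b m t z.2)).
    exact: is_deriveZ (is_derive_cauchy_integral_x z.1 wF bm z0).
  by apply/funext => t; rewrite wE.
have dy z : 0 < z.2 -> is_derive z.2 1 (fun t => w (z.1, t))
    (c * ((-1) ^+ (~~ b) * m%:R) * cauchy_integral F (~~ b) m.+1 z.1 z.2).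
  move=> z0; rewrite -mulrA.
  have := is_deriveZ c (is_derive_cauchy_integral_y z.1 wF bm z0).
  apply: near_eq_is_derive.
  by near=> t; rewrite wE//=; near: t; exact: lt_nbhsr.
split=> z z0; last 2 first.
- by rewrite /pdx derive1E; have [] := dx z z0.
- by rewrite /pdy derive1E; have [] := dy z z0.
split; [by have [] := dx z z0|by have [] := dy z z0|].
suff : w t @[t --> z] --> c * cauchy_integral F b m z.1 z.2 by rewrite -wE.
apply: cvg_trans (cvgM (cvg_cst c) (continuous_cauchy_integral wF bm z0)).
apply: near_eq_cvg; near=> t; rewrite wE//.
by near: t; exact: (open_nbhs_nbhs (conj open_upper_half_plane z0)).
Unshelve. all: end_near. Qed.

Lemma harmonic_cauchy_integral F b m c (w : R * R -> R) :
  weighted_integrable F -> (b < m)%N ->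
  (forall z, 0 < z.2 -> w z = c * cauchy_integral F b m z.1 z.2) ->
  harmonic_on (@upper_half_plane R) w.
Proof.
move=> wF bm wE.
have bm1 : (b < m.+1)%N by rewrite ltnW.
have Nbm1 : (~~ b < m.+1)%N by case: b m bm {wE bm1} => -[|[|]].
have lt_m2 b' : (b' < m.+2)%N by case: b'.
have [w_reg wx wy] := cauchy_integral_partials wF bm wE.
have [wx_reg wxx wxy] := cauchy_integral_partials wF bm1 wx.
have [wy_reg wyx wyy] := cauchy_integral_partials wF Nbm1 wy.
have [wxx_reg _ _] := cauchy_integral_partials wF (lt_m2 _) wxx.
have [wxy_reg _ _] := cauchy_integral_partials wF (lt_m2 _) wxy.
have [wyx_reg _ _] := cauchy_integral_partials wF (lt_m2 _) wyx.
have [wyy_reg _ _] := cauchy_integral_partials wF (lt_m2 _) wyy.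
split; [exact: open_upper_half_plane|split] => z z0; last first.
  by rewrite wxx// wyy// negbK; case: (b); rewrite !(expr0, expr1); ring.
have [? ? ?] := w_reg z z0; have [? ? ?] := wx_reg z z0.
have [? ? ?] := wy_reg z z0; have [_ _ ?] := wxx_reg z z0.
have [_ _ ?] := wxy_reg z z0; have [_ _ ?] := wyx_reg z z0.
by have [_ _ ?] := wyy_reg z z0; do !split.
Qed.

End half_plane.

Section poisson_derivatives.
Context {R : realType}.
Local Notation mu := (@lebesgue_measure R).
Implicit Types (n : nat) (x y : R) (F : R -> R).

Lemma poissonN y x : poisson y (- x) = poisson y x.
Proof. by rewrite /poisson sqrrN. Qed.

Lemma poissonE x y : poisson y x = - pi^-1 * cauchy_kernel false 1 x y.
Proof.
by rewrite /poisson /cauchy_kernel expr1 ImV/= invfM mulrCA !mulNr mulrN opprK.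
Qed.

Lemma derive1n_poisson_shift n x y : 0 < y ->
  derive1n n (fun t => poisson y (t - x)) =
  fun t => (-1) ^+ n * (- pi^-1 * n`!%:R * cauchy_kernel false n.+1 (t - x) y).
Proof.
move=> y0; elim: n => [|n IHn]; apply/funext => t.
  by rewrite derive1n0 poissonE expr0 fact0 mulr1 mul1r.
rewrite derive1nS IHn derive1E.
have dshift : is_derive t 1 (fun v : R => v - x) 1.
  by apply: is_derive_eq; rewrite oppr0 addr0.
have := @is_derive1_comp R (cauchy_kernel false n.+1 ^~ y) (fun v => v - x) t
  _ _ (is_derive_cauchy_kernel_x false n.+1 (t - x) y0) dshift.
move=> /(is_deriveZ (- pi^-1 * n`!%:R)) /(is_deriveZ ((-1) ^+ n)) [_ /= ->].
rewrite [(-1) ^+ n.+1]exprS factS natrM /GRing.scale/=.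
by move: (pi^-1 : R) => ?; ring.
Qed.

Lemma poisson_integrandE n F x y : 0 < y ->
  poisson_integrand n F y x =
  fun xi => (-1) ^+ n * (- pi^-1 * n`!%:R) *
    (F xi * cauchy_kernel false n.+1 (xi - x) y).
Proof.
move=> y0; rewrite /poisson_integrand derive1n_poisson_shift//.
by apply/funext => xi; rewrite mulrA mulrCA.
Qed.

Lemma integrable_poisson_integrand n F x y : weighted_integrable F -> 0 < y ->
  mu.-integrable setT (EFin \o poisson_integrand n F y x).
Proof.
move=> wF y0; rewrite poisson_integrandE//; apply: integrable_EFinZl.
exact: integrable_cauchy_integrand.
Qed.

Lemma poissonuE n F x y : weighted_integrable F -> 0 < y ->
  poissonu n F y x = - pi^-1 * n`!%:R * cauchy_integral F false n.+1 x y.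
Proof.
move=> wF y0; rewrite /poissonu poisson_integrandE// RintegralZl//; last first.
  exact: integrable_cauchy_integrand.
by rewrite -!mulrA signrMK.
Qed.

Lemma poissonUE F x y : weighted_integrable F -> 0 < y ->
  poissonU F y x = - pi^-1 * cauchy_integral F false 1 x y.
Proof.
move=> wF y0; rewrite -RintegralZl//; last exact: integrable_cauchy_integrand.
apply: eq_Rintegral => xi _.
by rewrite -poissonN opprB poissonE mulrCA.
Qed.

Lemma derive1n_poissonU n F y : weighted_integrable F -> 0 < y ->
  derive1n n (poissonU F y) = poissonu n F y.
Proof.
move=> wF y0; apply/funext => x; rewrite poissonuE//.
elim: n x => [|n IHn] x; first by rewrite derive1n0 poissonUE// fact0 mulr1.
rewrite derive1nS (funext IHn : derive1n n (poissonU F y) = _).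
have d := is_derive_cauchy_integral_x x wF (isT : (false < n.+1)%N) y0.
rewrite derive1E; have [_ /= ->] := is_deriveZ (- pi^-1 * n`!%:R) d.
by rewrite factS natrM /GRing.scale/=; move: (pi^-1 : R) => ?; ring.
Qed.

Lemma derivable_derive1n_poissonU n F x y : weighted_integrable F -> 0 < y ->
  derivable (derive1n n (poissonU F y)) x 1.
Proof.
move=> wF y0; rewrite derive1n_poissonU//.
rewrite (funext (fun t => poissonuE n t wF y0)).
have d := is_derive_cauchy_integral_x x wF (isT : (false < n.+1)%N) y0.
by have [] := is_deriveZ (- pi^-1 * n`!%:R) d.
Qed.

End poisson_derivatives.

(** * Integration by parts against Schwartz functions *)

Section slowly_increasing.
Context {R : realType}.
Local Notation mu := (@lebesgue_measure R).
Implicit Types (G f g phi : R -> R) (j k n q : nat).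

Lemma oneDsqrV_cvgy : (oneDsqr (x : R))^-1 @[x --> +oo] --> 0.
Proof.
apply/gtr0_cvgV0; first exact: nearW.
apply/cvgryPge => A; near=> x.
have x1 : 1 <= x by near: x; apply: nbhs_pinfty_ge; exact: num_real.
apply: (@le_trans _ _ x); last by rewrite /oneDsqr; nra.
by near: x; apply: nbhs_pinfty_ge; exact: num_real.
Unshelve. all: end_near. Qed.

Lemma oneDsqr_bound_cvg0 g (C : R) : (forall x, `|g x| <= C / oneDsqr x) ->
  g x @[x --> +oo] --> 0 /\ g x @[x --> -oo] --> 0.
Proof.
suff cvgy0 f : (forall x, `|f x| <= C / oneDsqr x) -> f x @[x --> +oo] --> 0.
  move=> gC; split; first exact: cvgy0.
  apply/cvgNy_compNP; apply: cvgy0 => x.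
  by rewrite (le_trans (gC _))// /oneDsqr sqrrN.
move=> fC; have Cy : C / oneDsqr (x : R) @[x --> +oo] --> 0.
  by rewrite -(mulr0 C); apply: cvgM; [exact: cvg_cst|exact: oneDsqrV_cvgy].
apply: norm_cvg0; apply: squeeze_cvgr (cvg_cst 0) Cy.
by apply: nearW => x; rewrite normr_ge0 fC.
Qed.

Lemma measurable_oneDsqrV : measurable_fun setT (fun x : R => (oneDsqr x)^-1).
Proof.
by apply: continuous_measurable_fun; exact: continuous_oneDsqrV.
Qed.

Lemma integrable_oneDsqrV :
  mu.-integrable setT (EFin \o (fun x : R => (oneDsqr x)^-1)).
Proof.
apply/integrableP; split.
  by apply/measurable_EFinP; exact: measurable_oneDsqrV.
under eq_integral do rewrite /= ger0_norm ?invr_ge0//.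
rewrite ge0_symfun_integralT.
- by rewrite -set_itvcy integral0y_oneDsqr -EFinM ltry.
- by move=> x; rewrite invr_ge0.
- exact: continuous_oneDsqrV.
- by move=> x /=; rewrite /oneDsqr sqrrN.
Qed.

Lemma integrable_oneDsqr_bound g (C : R) : measurable_fun setT g ->
  (forall x, `|g x| <= C / oneDsqr x) -> mu.-integrable setT (EFin \o g).
Proof.
move=> mg gC.
by apply: (le_integrable_EFin _ _ (integrable_EFinZl C integrable_oneDsqrV)).
Qed.

Lemma oneDsqrX_le q (x : R) : oneDsqr x ^+ q <= 2 ^+ q * (1 + `|x| ^+ q.*2).
Proof.
have [x1|x1] := leP `|x| 1.
  apply: (@le_trans _ _ (2 ^+ q)); last by rewrite ler_peMr ?exprn_ge0 ?lerDl.
  rewrite lerXn2r ?nnegrE// /oneDsqr -[x ^+ 2]real_normK ?num_real//.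
  by rewrite -[leRHS]/(1 + 1) lerD2l expr_le1.
rewrite mulrDr mulr1 ler_wpDl ?exprn_ge0// -mul2n exprM -exprMn.
rewrite lerXn2r ?nnegrE ?mulr_ge0 ?exprn_ge0// real_normK ?num_real//.
rewrite /oneDsqr mulr2n mulrDl mul1r lerD2r -real_normK ?num_real//.
by rewrite exprn_ege1// ltW.
Qed.

Lemma schwartz_bound phi j q : schwartz phi ->
  exists M : R, forall x, `|derive1n j phi x| <= M / oneDsqr x ^+ q.
Proof.
move=> [_ sphi]; have [M0 M0le] := sphi j 0%N; have [M2q M2qle] := sphi j q.*2.
exists (2 ^+ q * (M0 + M2q)) => x.
rewrite ler_pdivlMr ?exprn_gt0// mulrC.
apply: le_trans (ler_wpM2r (normr_ge0 _) (oneDsqrX_le q x)) _.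
rewrite -mulrA ler_wpM2l ?exprn_ge0// mulrDl mul1r lerD//.
by have := M0le x; rewrite expr0 mul1r.
Qed.

Definition slowly_increasing G :=
  (forall k (x : R), derivable (derive1n k G) x 1) /\
  (forall k, exists C q, forall x, `|derive1n k G x| <= C * oneDsqr x ^+ q).

Section integration_by_parts.
Variables G phi : R -> R.
Hypotheses (siG : slowly_increasing G) (sphi : schwartz phi).

Let dG k (x : R) : is_derive x 1 (derive1n k G) (derive1n k.+1 G x).
Proof. by rewrite derive1nS derive1E; exact/derivableP/siG.1. Qed.

Let dphi j (x : R) : is_derive x 1 (derive1n j phi) (derive1n j.+1 phi x).
Proof. by rewrite derive1nS derive1E; exact/derivableP/sphi.1. Qed.

Lemma slowly_increasing_schwartz_bound k j : exists C : R, forall x,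
  `|derive1n k G x * derive1n j phi x| <= C / oneDsqr x.
Proof.
have [C [q GC]] := siG.2 k; have [M phiM] := schwartz_bound j q.+1 sphi.
exists (C * M) => x; rewrite normrM.
apply: le_trans (ler_pM _ _ (GC x) (phiM x)) _ => //.
rewrite [leLHS](_ : _ = C * M / oneDsqr x)// exprS; field.
by rewrite expf_neq0 ?gt_eqF.
Qed.

Lemma continuous_slowly_increasing_schwartz k j :
  continuous (fun x => derive1n k G x * derive1n j phi x).
Proof.
by move=> x; apply: cvgM;
  [exact: is_derive_continuous (dG k x)|exact: is_derive_continuous (dphi j x)].
Qed.

Lemma integrable_slowly_increasing_schwartz k j : mu.-integrable setT
  (EFin \o (fun x => derive1n k G x * derive1n j phi x)).
Proof.
have [C GphiC] := slowly_increasing_schwartz_bound k j.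
apply: integrable_oneDsqr_bound GphiC; apply: continuous_measurable_fun.
exact: continuous_slowly_increasing_schwartz.
Qed.

Lemma Rintegral_by_parts k j :
  \int[mu]_x (derive1n k.+1 G x * derive1n j phi x) =
  - \int[mu]_x (derive1n k G x * derive1n j.+1 phi x).
Proof.
have [C GphiC] := slowly_increasing_schwartz_bound k j.
have [Gphiy GphiNy] := oneDsqr_bound_cvg0 GphiC.
have dGphi := integrable_slowly_increasing_schwartz k.+1 j.
have Gdphi := integrable_slowly_increasing_schwartz k j.+1.
apply/eqP; rewrite -addr_eq0 -RintegralD//; apply/eqP.
rewrite -(subrr 0).
apply: (Rintegral_is_derive _ _ (integrable_EFinD dGphi Gdphi) GphiNy Gphiy).
- move=> x; have := is_deriveM (dG k x) (dphi j x) => /is_derive_eq; apply.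
  by rewrite /GRing.scale/= addrC mulrC.
- by move=> x; apply: cvgD; exact: continuous_slowly_increasing_schwartz.
Qed.

Lemma Rintegral_iterated_by_parts n j :
  \int[mu]_x (derive1n n G x * derive1n j phi x) =
  (-1) ^+ n * \int[mu]_x (G x * derive1n (n + j) phi x).
Proof.
elim: n j => [|n IHn] j; first by rewrite expr0 mul1r.
by rewrite Rintegral_by_parts IHn exprS mulN1r mulNr addSnnS.
Qed.

End integration_by_parts.

Lemma is_nth_distr_deriv_derive1n G n : slowly_increasing G ->
  is_nth_distr_deriv n (derive1n n G) G.
Proof.
move=> siG phi sphi; split.
  exact: integrable_slowly_increasing_schwartz 0%N.
by have := Rintegral_iterated_by_parts siG sphi n 0; rewrite addn0.
Qed.

Lemma slowly_increasing_poissonU (F : R -> R) y :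
  weighted_integrable F -> 0 < y -> slowly_increasing (poissonU F y).
Proof.
move=> wF y0; split=> [k x|k]; first exact: derivable_derive1n_poissonU.
have [C C0 CIle] := cauchy_integral_bound y wF (ltn0Sn k : (false < k.+1)%N) y0.
exists (`|- pi^-1 * k`!%:R| * C), 1%N => x.
rewrite derive1n_poissonU// poissonuE// normrM -mulrA ler_wpM2l//.
by rewrite expr1 CIle// lexx.
Qed.

End slowly_increasing.

(** * Averages against a probability density *)

Section reflection.
Context {R : realType}.
Local Notation mu := (@lebesgue_measure R).
Implicit Types (a s : R) (f : R -> \bar R).

Lemma measurable_subr a :
  measurable_fun setT ((fun x : R => a - x) : R -> measurableTypeR R).
Proof. exact: measurable_funB. Qed.

Lemma lebesgue_measure_reflection a (A : set R) : measurable A ->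
  pushforward mu ((fun x => a - x) : _ -> measurableTypeR R) A = mu A.
Proof.
have mr := measurable_subr a.
pose mfun_mr := isMeasurableFun.Build _ _ _ _ _ mr.
pose r : {mfun R >-> measurableTypeR R} :=
  HB.pack ((fun x : R => a - x) : R -> measurableTypeR R) mfun_mr.
move=> mA; apply/esym.
apply: (@lebesgue_measure_unique R (pushforward mu r)) => //= _ [[u v]] _ <-.
rewrite /pushforward/= (_ : _ @^-1` _ = `[a - v, a - u[%classic).
  rewrite !lebesgue_measure_itv/= !lte_fin ltrD2l ltrN2; case: ifPn => // _.
  by rewrite -!EFinD; congr EFin; ring.
by apply/seteqP; split=> x /=; rewrite !in_itv/= => /andP[? ?];
  apply/andP; split; lra.
Qed.

Lemma ge0_integral_reflection a f :
  measurable_fun setT f -> (forall x, 0 <= f x)%E ->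
  (\int[mu]_x f (a - x)%R = \int[mu]_x f x)%E.
Proof.
move=> mf f0; pose r := (fun x : R => a - x) : _ -> measurableTypeR R.
rewrite -[LHS]/(\int[mu]_x (f \o r) x)%E -(preimage_setT r).
have mr := measurable_subr a; rewrite -ge0_integral_pushforward//=.
by apply: eq_measure_integral => A mA _; exact: lebesgue_measure_reflection.
Qed.

Lemma ge0_integral_translation s f :
  measurable_fun setT f -> (forall x, 0 <= f x)%E ->
  (\int[mu]_x f (x + s)%R = \int[mu]_x f x)%E.
Proof.
move=> mf f0; rewrite -(ge0_integral_reflection s mf)//.
rewrite -(@ge0_integral_reflection 0 (fun x => f (s - x)))//.
  by apply: eq_integral => x _; rewrite sub0r opprK addrC.
exact: (measurableT_comp mf (measurable_subr s)).
Qed.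

End reflection.

Section jensen.
Context d (T : measurableType d) (R : realType) (mu : {measure set T -> \bar R}).

(* Hoelder's inequality for the factorization [w g = (w^(1/p) g) w^(1/q)]. *)
Lemma powR_jensen (p : R) (w g : T -> R) : 1 <= p ->
  measurable_fun setT w -> measurable_fun setT g ->
  (forall x, 0 <= w x) -> (forall x, 0 <= g x) ->
  (\int[mu]_x (w x)%:E = 1)%E ->
  ((\int[mu]_x (w x * g x)%:E) `^ p <= \int[mu]_x (w x * g x `^ p)%:E)%E.
Proof.
move=> p1 mw mg w0 g0 w1; move: p1; rewrite le_eqVlt => /predU1P[<-|p1].
  rewrite poweRe1; last by apply: integral_ge0 => x _; rewrite lee_fin mulr_ge0.
  by under [leRHS]eq_integral do rewrite powRr1//.
have p0 : 0 < p by lra.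
pose q := p / (p - 1); have q0 : 0 < q by rewrite divr_gt0//; lra.
have pq : p^-1 + q^-1 = 1 by rewrite /q; field; rewrite !gt_eqF//; lra.
have mpow (r : R) (h : T -> R) : measurable_fun setT h ->
    measurable_fun setT (fun x => h x `^ r).
  exact: (measurableT_comp (measurable_powR r)).
have mf : measurable_fun setT (fun x => w x `^ p^-1 * g x).
  by apply: measurable_funM => //; exact: mpow.
have powRV r (x : R) : 0 < r -> 0 <= x -> (`|x `^ r^-1| `^ r = x)%R.
  by move=> r0 x0; rewrite ger0_norm ?powR_ge0// -powRrM mulVf ?gt_eqF// powRr1.
have Nw : Lnorm mu q%:E (EFin \o (fun x => w x `^ q^-1)) = 1%E.
  rewrite unlock; under eq_integral do rewrite /= powRV//.
  by rewrite w1 poweR1r.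
have := hoelder mu mf (mpow q^-1 w mw) p0 q0 pq.
rewrite Lnorm1 Nw mule1 => wg_le.
have -> : (\int[mu]_x (w x * g x)%:E =
    \int[mu]_x `|w x `^ p^-1 * g x * w x `^ q^-1|%:E)%E.
  apply: eq_integral => x _; congr EFin.
  rewrite ger0_norm ?mulr_ge0 ?powR_ge0// mulrAC.
  by rewrite -powRD ?pq ?oner_eq0// powRr1.
apply: le_trans (gt0_ler_poweR (ltW p0) _ _ wg_le) _.
- by rewrite in_itv/= leey andbT integral_ge0.
- by rewrite in_itv/= leey andbT Lnorm_ge0.
rewrite poweR_Lnorm ?gt_eqF//.
under eq_integral do rewrite /= normrM powRM// powRV// ger0_norm//.
exact: lexx.
Qed.

End jensen.

Section convolution.
Context {R : realType}.
Local Notation mu := (@lebesgue_measure R).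
Implicit Types f g : R -> R.

Definition convolution f g x : R := \int[mu]_t (f t * g (x - t)).

Lemma measurable_convolution f g : measurable_fun setT f ->
  measurable_fun setT g -> measurable_fun setT (convolution f g).
Proof.
move=> mf mg.
pose h (z : measurableTypeR R * measurableTypeR R) :=
  (f z.2 * g (z.1 - z.2))%:E.
have mh : measurable_fun setT h.
  apply/measurable_EFinP; apply: measurable_funM.
    exact: (measurableT_comp mf measurable_snd).
  by apply: (measurableT_comp mg); exact: measurable_funB.
suff mI : measurable_fun setT (fun x : R => \int[mu]_t (f t * g (x - t))%:E)%E.
  exact: (measurableT_comp (fine_measurable measurableT) mI).
rewrite (_ : (fun x => _) = fun x =>
    (\int[mu]_t h^\+ (x, t) - \int[mu]_t h^\- (x, t))%E).
  have mF k := @measurable_fun_fubini_tonelli_F _ _ _ _ _ mu k.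
  by apply: emeasurable_funB; apply: mF => //;
    [exact: measurable_funepos|exact: measurable_funeneg].
apply/funext => x; rewrite integralE.
congr (_ - _)%E; apply: eq_integral => t _.
- by rewrite !funeposE.
- by rewrite !funenegE.
Qed.

Lemma measurable_translation s f : measurable_fun setT f ->
  measurable_fun setT (fun x : R => f (x + s)).
Proof. by move=> mf; apply: (measurableT_comp mf); exact: measurable_funD. Qed.

Lemma measurable_normr_powR f (p : R) : measurable_fun setT f ->
  measurable_fun setT (fun x => (`|f x| `^ p)%:E).
Proof.
move=> mf; apply/measurable_EFinP.
by apply: (measurableT_comp (measurable_powR p)); exact: measurableT_comp.
Qed.

Lemma integral_translation_normr_powR f (p s : R) : measurable_fun setT f ->
  (\int[mu]_x (`|f (x + s)| `^ p)%:E = \int[mu]_x (`|f x| `^ p)%:E)%E.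
Proof.
move=> mf; apply: (@ge0_integral_translation _ s (fun x => (`|f x| `^ p)%:E)).
  exact: measurable_normr_powR.
by move=> x; rewrite lee_fin powR_ge0.
Qed.

Definition probability_density f := [/\ measurable_fun setT f,
  forall x, 0 <= f x & (\int[mu]_x (f x)%:E = 1)%E].

Section convolution_density.
Variables (p : R) (w : R -> R).
Hypotheses (p1 : 1 <= p) (w_density : probability_density w).

Let p0 : 0 < p. Proof. exact: lt_le_trans p1. Qed.

Let mw : measurable_fun setT w. Proof. by case: w_density. Qed.

Let w0 s : 0 <= w s. Proof. by case: w_density. Qed.

Let w1 : (\int[mu]_s (w s)%:E = 1)%E. Proof. by case: w_density. Qed.

Let mwr x : measurable_fun setT (fun t : R => w (x - t)).
Proof. exact: (measurableT_comp mw (measurable_subr x)). Qed.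

Let wr1 x : (\int[mu]_t (w (x - t))%:E = 1)%E.
Proof.
rewrite -w1 (@ge0_integral_reflection _ x (fun s => (w s)%:E))//.
exact/measurable_EFinP.
Qed.

Lemma normr_convolution_sub_le f x (c : R) :
  mu.-integrable setT (EFin \o (fun t => f t * w (x - t))) ->
  ((`|convolution f w x - c|)%:E <= \int[mu]_t (w (x - t) * `|f t - c|)%:E)%E.
Proof.
move=> fwi; have wi : mu.-integrable setT (EFin \o (fun t => w (x - t))).
  apply/integrableP; split; first by apply/measurable_EFinP; exact: mwr.
  by under eq_integral do rewrite /= ger0_norm//; rewrite wr1 ltry.
have cwi := integrable_EFinZl (- c) wi; have Di := integrable_EFinD fwi cwi.
have -> : convolution f w x - c =
    \int[mu]_t (f t * w (x - t) + - c * w (x - t)).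
  rewrite RintegralD// RintegralZl// [in RHS]/Rintegral.
  by rewrite (_ : fine (\int[mu]_t (w (x - t))%:E) = 1) ?mulr1// wr1.
rewrite EFin_normr_Rintegral//.
have mD : measurable_fun setT
    (EFin \o (fun t => f t * w (x - t) + - c * w (x - t))).
  by case/integrableP: Di.
apply: le_trans (le_abse_integral mu measurableT mD) _.
rewrite (_ : (\int[mu]_t _ = \int[mu]_t (w (x - t) * `|f t - c|)%:E)%E)//.
apply: eq_integral => t _ /=.
by rewrite -mulrDl normrM (ger0_norm (w0 _)) mulrC.
Qed.

Lemma powR_convolution_sub_le f x (c : R) : measurable_fun setT f ->
  mu.-integrable setT (EFin \o (fun t => f t * w (x - t))) ->
  ((`|convolution f w x - c| `^ p)%:E <=
   \int[mu]_s (w s * `|f (x - s) - c| `^ p)%:E)%E.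
Proof.
move=> mf fwi.
have mfc : measurable_fun setT (fun t => `|f t - c|).
  by apply: measurableT_comp => //; exact: measurable_funB.
have jensen_x := @powR_jensen _ _ R mu p (fun t => w (x - t))
  (fun t => `|f t - c|) p1 (mwr x) mfc (fun=> w0 _) (fun=> normr_ge0 _) (wr1 x).
have -> : (\int[mu]_s (w s * `|f (x - s) - c| `^ p)%:E =
    \int[mu]_t (w (x - t) * `|f t - c| `^ p)%:E)%E.
  rewrite -(@ge0_integral_reflection _ x
    (fun t => (w (x - t) * `|f t - c| `^ p)%:E)).
  - by apply: eq_integral => s _; rewrite subKr.
  - apply/measurable_EFinP; apply: measurable_funM; first exact: mwr.
    exact: (measurableT_comp (measurable_powR p) mfc).
  - by move=> t; rewrite lee_fin mulr_ge0 ?powR_ge0.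
apply: le_trans jensen_x; rewrite -poweR_EFin.
apply: gt0_ler_poweR; rewrite ?(ltW p0)//.
- by rewrite in_itv/= leey andbT lee_fin.
- rewrite in_itv/= leey andbT integral_ge0// => t _.
  by rewrite lee_fin mulr_ge0.
- exact: normr_convolution_sub_le.
Qed.

(* [g = 0] gives Young's inequality, while [g = f] bounds the distance from [f]
   to its average by the moduli of continuity of [f]. *)
Lemma Lp_convolution_sub_le f g :
  measurable_fun setT f -> measurable_fun setT g ->
  (forall x, mu.-integrable setT (EFin \o (fun t => f t * w (x - t)))) ->
  (\int[mu]_x (`|convolution f w x - g x| `^ p)%:E <=
   \int[mu]_s ((w s)%:E * \int[mu]_x (`|f (x - s)%R - g x| `^ p)%:E))%E.
Proof.
move=> mf mg fwi.
pose h (z : measurableTypeR R * measurableTypeR R) :=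
  (w z.2 * `|f (z.1 - z.2) - g z.1| `^ p)%:E.
have h0 z : (0 <= h z)%E by rewrite lee_fin mulr_ge0 ?powR_ge0.
have mh : measurable_fun setT h.
  apply/measurable_EFinP; apply: measurable_funM.
    exact: (measurableT_comp mw measurable_snd).
  apply: (measurableT_comp (measurable_powR p)); apply: measurableT_comp => //.
  apply: measurable_funB; last exact: (measurableT_comp mg measurable_fst).
  by apply: (measurableT_comp mf); exact: measurable_funB.
apply: (@le_trans _ _ (\int[mu]_x \int[mu]_s h (x, s))%E).
  apply: ge0_le_integral => //.
  - apply: measurable_normr_powR; apply: measurable_funB => //.
    exact: measurable_convolution.
  - exact: (measurable_fun_fubini_tonelli_F (m2 := mu) h mh h0).
  - by move=> x _; exact: powR_convolution_sub_le.
rewrite (fubini_tonelli (m1 := mu) (m2 := mu) h mh h0).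
rewrite (_ : (\int[mu]_s _ = \int[mu]_s
  ((w s)%:E * \int[mu]_x (`|f (x - s)%R - g x| `^ p)%:E))%E)//.
apply: eq_integral => s _; rewrite -ge0_integralZl_EFin.
- by apply: eq_integral => x _; rewrite -EFinM.
- exact: measurableT.
- by move=> x _; rewrite lee_fin powR_ge0.
- apply: measurable_normr_powR; apply: measurable_funB => //.
  by apply: (measurableT_comp mf); exact: measurable_funB.
- exact: w0.
Qed.

Lemma Lp_convolution_le f : measurable_fun setT f ->
  (forall x, mu.-integrable setT (EFin \o (fun t => f t * w (x - t)))) ->
  (\int[mu]_x (`|convolution f w x| `^ p)%:E <= \int[mu]_x (`|f x| `^ p)%:E)%E.
Proof.
move=> mf fwi.
have := @Lp_convolution_sub_le f (cst 0) mf (measurable_cst _) fwi.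
under eq_integral do rewrite subr0.
move=> /le_trans; apply; set I := (X in (_ <= X)%E).
rewrite (_ : (\int[mu]_s _ = \int[mu]_s ((w s)%:E * I))%E); last first.
  apply: eq_integral => s _.
  rewrite -[I](integral_translation_normr_powR p (- s) mf).
  by under eq_integral do rewrite subr0.
rewrite ge0_integralZr//.
- by rewrite w1 mul1e.
- exact/measurable_EFinP.
- by move=> s _; rewrite lee_fin.
- by apply: integral_ge0 => x _; rewrite lee_fin powR_ge0.
Qed.

End convolution_density.
End convolution.

(** * Continuity of translations in Lp *)

Section clamp.
Context {R : realDomainType}.
Implicit Types c u v N x : R.

Definition clamp c v : R := Num.max (- c) (Num.min c v).

Lemma normr_clamp_le c v : 0 <= c -> `|clamp c v| <= c.
Proof.
by move=> c0; rewrite /clamp ler_norml maxEle minEle; do 2 case: ifP; lra.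
Qed.

Lemma clamp0 v : clamp 0 v = 0.
Proof. by apply/eqP; rewrite -normr_le0 normr_clamp_le. Qed.

Lemma clamp_id c v : `|v| <= c -> clamp c v = v.
Proof. by rewrite ler_norml => /andP[? ?]; rewrite /clamp min_r ?max_r. Qed.

Lemma normr_sub_clamp_le c v : 0 <= c -> `|v - clamp c v| <= `|v|.
Proof.
rewrite /clamp ler_norml maxEle minEle.
have := ler_norm v; have := ler_norm (- v); rewrite normrN.
by do 2 case: ifP; lra.
Qed.

Lemma clamp_nonexpansive c u v : `|clamp c u - clamp c v| <= `|u - v|.
Proof.
rewrite /clamp ler_norml !maxEle !minEle.
have := ler_norm (u - v); have := ler_norm (v - u); rewrite distrC.
by do 4 case: ifP; lra.
Qed.

Definition tent N x : R := N * Num.max 0 (N - `|x|).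

Lemma tent_ge0 N x : 0 <= N -> 0 <= tent N x.
Proof. by move=> N0; rewrite mulr_ge0// le_max lexx. Qed.

Lemma tent_le N x : 0 <= N -> tent N x <= N ^+ 2.
Proof. by move=> N0; rewrite ler_wpM2l// ge_max N0 gerBl normr_ge0. Qed.

Lemma tent_eq0 N x : N < `|x| -> tent N x = 0.
Proof. by move=> xN; rewrite /tent max_l ?mulr0// subr_le0 ltW. Qed.

End clamp.

Section ereal_cvg0.
Context {R : realType} {T : Type} {F : set_system T} {FF : Filter F}.
Implicit Type u : T -> \bar R.

Lemma ge0_cvge0P u : (\forall t \near F, 0 <= u t)%E ->
  u @ F --> 0%E <->
  (forall e : R, 0 < e -> \forall t \near F, (u t <= e%:E)%E).
Proof.
move=> u0; split=> [/fine_cvgP[ufin /cvgr0Pnorm_le uF] e e0|uF].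
  near=> t; have ut : u t \is a fin_num by near: t.
  rewrite -(fineK ut) lee_fin (le_trans (ler_norm _))//.
  by near: t; exact: uF.
have ufin e t : (0 <= u t)%E -> (u t <= e%:E)%E -> u t \is a fin_num.
  by move=> ut0 ute; rewrite ge0_fin_numE// (le_lt_trans ute)// ltry.
apply/fine_cvgP; split.
  by apply: filterS2 u0 (uF 1 ltr01) => t; exact: ufin.
apply/cvgr0Pnorm_le => e e0; apply: filterS2 u0 (uF e e0) => t ut0 ute /=.
by rewrite ger0_norm ?fine_ge0// -lee_fin fineK// (ufin _ _ ut0 ute).
Unshelve. all: end_near. Qed.

Lemma ge0_cvge0_poweR u (r : R) : 0 < r -> (forall t, 0 <= u t)%E ->
  u @ F --> 0%E -> (u t `^ r)%E @[t --> F] --> 0%E.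
Proof.
move=> r0 u0 /(ge0_cvge0P (nearW _ u0)) uF; apply/ge0_cvge0P => [|e e0].
  by apply: nearW => t; exact: poweR_ge0.
apply: filterS (uF _ (powR_gt0 r^-1 e0)) => t ute.
have -> : e%:E = ((e `^ r^-1)%:E `^ r)%E.
  by rewrite poweR_EFin -powRrM mulVf ?gt_eqF// powRr1// ltW.
apply: gt0_ler_poweR => //; first exact: ltW.
- by rewrite in_itv/= leey andbT.
- by rewrite in_itv/= leey andbT lee_fin powR_ge0.
Qed.

End ereal_cvg0.

Section Lpnorm.
Context {R : realType} (p : R).
Local Notation mu := (@lebesgue_measure R).
Hypothesis p1 : 1 <= p.
Implicit Types f g h : R -> R.

Let p0 : 0 < p. Proof. exact: lt_le_trans p1. Qed.

Lemma Lpnorm_poweR f : (Lpnorm p f `^ p = \int[mu]_x (`|f x| `^ p)%:E)%E.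
Proof. by rewrite /Lpnorm poweR_Lnorm ?gt_eqF. Qed.

Lemma LpnormE f : (Lpnorm p f = (\int[mu]_x (`|f x| `^ p)%:E) `^ p^-1)%E.
Proof. by rewrite /Lpnorm unlock. Qed.

Lemma integral_normr_powR_ge0 f : (0 <= \int[mu]_x (`|f x| `^ p)%:E)%E.
Proof. by apply: integral_ge0 => x _; rewrite lee_fin powR_ge0. Qed.

Lemma Lpnorm_ge0 f : (0 <= Lpnorm p f)%E.
Proof. exact: Lnorm_ge0. Qed.

Lemma le_Lpnorm f g :
  (\int[mu]_x (`|f x| `^ p)%:E <= \int[mu]_x (`|g x| `^ p)%:E)%E ->
  (Lpnorm p f <= Lpnorm p g)%E.
Proof.
move=> fg; rewrite !LpnormE; apply: gt0_ler_poweR fg.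
- by rewrite invr_ge0 ltW.
- by rewrite in_itv/= leey integral_normr_powR_ge0.
- by rewrite in_itv/= leey integral_normr_powR_ge0.
Qed.

Lemma Lpnorm_lty f : inLp p f -> (Lpnorm p f < +oo)%E.
Proof. by move=> [_ fi]; rewrite LpnormE poweR_lty. Qed.

Lemma Lpnorm_powR_cvg0P T (F : set_system T) (FF : Filter F) (u : T -> R -> R) :
  (Lpnorm p (u t) @[t --> F] --> 0%E) <->
  ((\int[mu]_x (`|u t x| `^ p)%:E)%E @[t --> F] --> 0%E).
Proof.
under eq_fun do rewrite LpnormE; split=> u0.
  under eq_fun do rewrite -Lpnorm_poweR LpnormE.
  by apply: ge0_cvge0_poweR => // t; exact: poweR_ge0.
apply: ge0_cvge0_poweR; rewrite ?invr_gt0// => t.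
exact: integral_normr_powR_ge0.
Qed.

Lemma Lpnorm_cvg0P T (F : set_system T) (FF : Filter F) (u : T -> R -> R) :
  (Lpnorm p (u t) @[t --> F] --> 0%E) <->
  (forall e : R, 0 < e -> \forall t \near F, (Lpnorm p (u t) <= e%:E)%E).
Proof. by apply: ge0_cvge0P; apply: nearW => t; exact: Lpnorm_ge0. Qed.

Lemma Lpnorm_distC f g :
  Lpnorm p (fun x => f x - g x) = Lpnorm p (fun x => g x - f x).
Proof. by rewrite !LpnormE; under eq_integral do rewrite distrC. Qed.

Lemma inLp_integrable_powR f : inLp p f ->
  mu.-integrable setT (fun x => (`|f x| `^ p)%:E).
Proof.
move=> [mf fi]; apply/integrableP; split; first exact: measurable_normr_powR.
by under eq_integral do rewrite /= ger0_norm ?powR_ge0//.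
Qed.

Lemma LpnormB_le f g : measurable_fun setT f -> measurable_fun setT g ->
  (Lpnorm p (fun x => f x - g x)%R <= Lpnorm p f + Lpnorm p g)%E.
Proof.
move=> mf mg; have <- : Lpnorm p (fun x => - g x) = Lpnorm p g.
  by rewrite !LpnormE; under eq_integral do rewrite normrN.
by apply: minkowski_EFin => //; exact: measurableT_comp.
Qed.

Lemma Lpnorm_triangle f g h : measurable_fun setT f -> measurable_fun setT g ->
  measurable_fun setT h ->
  (Lpnorm p (fun x => f x - h x)%R <=
   Lpnorm p (fun x => f x - g x)%R + Lpnorm p (fun x => g x - h x)%R)%E.
Proof.
move=> mf mg mh; rewrite (Lpnorm_distC g).
rewrite (_ : (fun x => f x - h x) = (fun x => (f x - g x) - (h x - g x))).
  by apply: LpnormB_le; exact: measurable_funB.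
by apply/funext => x; rewrite opprB addrA subrK.
Qed.

End Lpnorm.

Section Lp_translation.
Context {R : realType} (p : R).
Local Notation mu := (@lebesgue_measure R).
Hypothesis p1 : 1 <= p.
Implicit Types (f g h : R -> R) (N s : R).

Let p0 : 0 < p. Proof. exact: lt_le_trans p1. Qed.

Lemma continuous_tent N : continuous (tent N).
Proof.
move=> x; apply: cvgM; first exact: cvg_cst.
apply: (@continuous_max R R (cst 0) (fun t => N - `|t|)); first exact: cvg_cst.
by apply: cvgB; [exact: cvg_cst|exact: norm_continuous].
Qed.

Lemma continuous_clamp f g : continuous f -> continuous g ->
  continuous (fun x => clamp (f x) (g x)).
Proof.
move=> cf cg x; apply: (@continuous_max R R (fun t => - f t) (f \min g)).
  by apply: cvgN; exact: cf.
by apply: continuous_min; [exact: cf|exact: cg].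
Qed.

Lemma measurable_clamp f g : measurable_fun setT f -> measurable_fun setT g ->
  measurable_fun setT (fun x => clamp (f x) (g x)).
Proof.
move=> mf mg; apply: measurable_maxr; last exact: measurable_minr.
exact: measurableT_comp.
Qed.

(* Truncating at height [tent N] bounds a function and its support at once. *)
Definition tent_trunc N f x : R := clamp (tent N x) (f x).

Lemma normr_tent_trunc_le N f x : 0 <= N -> `|tent_trunc N f x| <= tent N x.
Proof. by move=> N0; rewrite normr_clamp_le// tent_ge0. Qed.

Lemma tent_trunc_eq0 N f x : N < `|x| -> tent_trunc N f x = 0.
Proof. by move=> xN; rewrite /tent_trunc tent_eq0// clamp0. Qed.

Lemma continuous_tent_trunc N f : continuous f -> continuous (tent_trunc N f).
Proof. by apply: continuous_clamp; exact: continuous_tent. Qed.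

Lemma measurable_tent_trunc N f : measurable_fun setT f ->
  measurable_fun setT (tent_trunc N f).
Proof.
apply: measurable_clamp; apply: continuous_measurable_fun.
exact: continuous_tent.
Qed.

Lemma tent_trunc_cvg_Lp f : inLp p f ->
  Lpnorm p (fun x => f x - tent_trunc n%:R f x) @[n --> \oo] --> 0%E.
Proof.
move=> /[dup] fLp [mf _]; apply/(Lpnorm_powR_cvg0P p1).
pose d_ (n : nat) x := (`|f x - tent_trunc n%:R f x| `^ p)%:E.
have md_ n : measurable_fun setT (d_ n).
  apply: measurable_normr_powR; apply: measurable_funB => //.
  exact: measurable_tent_trunc.
have d_cvg : {ae mu, forall x, setT x ->
    d_ ^~ x @ \oo --> (cst 0%E : R -> \bar R) x}.
  apply: aeW => x _; apply: cvg_near_cst; near=> n.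
  have nx : `|x| + 1 <= n%:R by near: n; exact: nbhs_infty_ger.
  have nf : `|f x| <= n%:R by near: n; exact: nbhs_infty_ger.
  rewrite /d_ /tent_trunc clamp_id ?subrr ?normr0 ?powR0 ?gt_eqF//.
  rewrite (le_trans nf)//.
  by rewrite ler_peMr// le_max; apply/orP; right; lra.
have d_le : {ae mu, forall x n, setT x -> (`|d_ n x| <= (`|f x| `^ p)%:E)%E}.
  apply: aeW => x n _; rewrite /d_ /= ger0_norm ?powR_ge0// lee_fin.
  apply: ge0_ler_powR; rewrite ?nnegrE ?(ltW p0)//.
  by rewrite normr_sub_clamp_le// tent_ge0.
have [_ _] := @dominated_convergence _ _ R mu setT measurableT d_ (cst 0%E)
  _ md_ (measurable_cst _) d_cvg (inLp_integrable_powR fLp) d_le.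
by rewrite integral0.
Unshelve. all: end_near. Qed.

Lemma powR_le_linear (M t : R) : 0 <= t <= M -> t `^ p <= M `^ (p - 1) * t.
Proof.
move=> /andP[t0 tM]; rewrite -mulr_powRB1// mulrC ler_wpM2r//.
by apply: ge0_ler_powR; rewrite ?nnegrE ?subr_ge0// (le_trans t0).
Qed.

Lemma powR_sub_clamp_le (c M u v : R) : c <= M -> `|u| <= c ->
  `|u - clamp c v| `^ p <= (2 * M) `^ (p - 1) * `|u - v|.
Proof.
move=> cM uc; have c0 := le_trans (normr_ge0 _) uc.
have uvM : 0 <= `|u - clamp c v| <= 2 * M.
  rewrite normr_ge0 (le_trans (ler_normB _ _))//.
  by have := normr_clamp_le v c0; lra.
rewrite (le_trans (powR_le_linear uvM))// ler_wpM2l ?powR_ge0//.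
by rewrite -[u in `|u - clamp _ _|](clamp_id uc) clamp_nonexpansive.
Qed.

Lemma tent_trunc_approx f N : 0 <= N -> measurable_fun setT f ->
  (forall x, `|f x| <= tent N x) ->
  exists2 g : nat -> R -> R, forall n, continuous (g n) &
    Lpnorm p (fun x => f x - tent_trunc N (g n) x) @[n --> \oo] --> 0%E.
Proof.
move=> N0 mf fN; pose E : set R := `[- N, N]%classic.
have mE : measurable E by exact: measurable_itv.
have muE : (mu E < +oo)%E.
  by rewrite lebesgue_measure_itv/=; case: ifP; rewrite ?ltry// -EFinD ltry.
have fi : mu.-integrable E (EFin \o f).
  apply: measurable_bounded_integrable => //; first exact: measurable_funTS.
  exists (N ^+ 2); split=> [|M NM x _ /=]; first exact: num_real.
  by rewrite (le_trans (fN x))// (le_trans (tent_le _ _))// ltW.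
have [g [cg _ g_cvg]] := approximation_continuous_integrable mE muE fi.
exists g => //; apply/(Lpnorm_powR_cvg0P p1).
pose K := (2 * N ^+ 2) `^ (p - 1).
have Kg_cvg :
    (K%:E * \int[mu]_(x in E) `|(f x - g n x)%:E|)%E @[n --> \oo] --> 0%E.
  by rewrite -(mule0 K%:E); apply: cvgeZl.
apply: squeeze_cvge (cvg_cst 0%E) Kg_cvg; apply: nearW => n.
have mg := continuous_measurable_fun (cg n).
have mfg : measurable_fun setT (fun x => `|(f x - g n x)%:E|)%E.
  apply/measurable_EFinP; apply: measurableT_comp => //.
  exact: measurable_funB.
rewrite integral_normr_powR_ge0/= -ge0_integralZl_EFin ?powR_ge0//; last first.
  exact: measurable_funTS.
rewrite [leRHS]integral_mkcond; apply: ge0_le_integral => //.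
- apply: measurable_normr_powR; apply: measurable_funB => //.
  exact: measurable_tent_trunc.
- apply/(measurable_restrictT _ _).1 => //.
  by apply: measurable_funeM; exact: measurable_funTS.
move=> x _; rewrite patchE; case: ifPn => [_|].
  by rewrite -EFinM lee_fin powR_sub_clamp_le// tent_le.
rewrite notin_setE /E/= in_itv/= -ler_norml => /negP; rewrite -ltNge => xN.
have := fN x; rewrite tent_eq0// normr_le0 => /eqP ->.
by rewrite tent_trunc_eq0// subrr normr0 powR0// gt_eqF.
Qed.

Definition compactly_supported N h := [/\ continuous h,
  forall x, `|h x| <= N & forall x, N < `|x| -> h x = 0].

Lemma compactly_supported_dense_Lp f (e : R) : inLp p f -> 0 < e ->
  exists h N, compactly_supported N h /\
    (Lpnorm p (fun x => f x - h x)%R <= e%:E)%E.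
Proof.
move=> /[dup] fLp [mf _] e0; have e2_gt0 : 0 < e / 2 by rewrite divr_gt0.
have /Lpnorm_cvg0P/(_ _ e2_gt0)/filter_ex[n f_trunc] := tent_trunc_cvg_Lp fLp.
pose N : R := n%:R; have N0 : 0 <= N by rewrite ler0n.
have mfn : measurable_fun setT (tent_trunc N f) by exact: measurable_tent_trunc.
have [g cg] := tent_trunc_approx N0 mfn (fun x => normr_tent_trunc_le f x N0).
move=> /Lpnorm_cvg0P/(_ _ e2_gt0)/filter_ex[k trunc_g].
have ch : continuous (tent_trunc N (g k)) by exact: continuous_tent_trunc.
exists (tent_trunc N (g k)), (Num.max N (N ^+ 2)); split; first split => //.
- move=> x; have gN := normr_tent_trunc_le (g k) x N0.
  by rewrite le_max (le_trans gN (tent_le _ N0)) orbT.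
- by move=> x; rewrite gt_max => /andP[xN _]; exact: tent_trunc_eq0.
apply: le_trans (Lpnorm_triangle p1 mf mfn (continuous_measurable_fun ch)) _.
by rewrite (splitr e) EFinD leeD.
Qed.

Lemma normr_translation_sub_le h N x s : compactly_supported N h -> `|s| < 1 ->
  `|h (x + s) - h x| <= 2 * N * \1_`[- (N + 1), N + 1]%classic x.
Proof.
move=> [_ hN h0] s1; rewrite indicE; case: (boolP (x \in _)) => [_|].
  rewrite mulr1 (le_trans (ler_normB _ _))//.
  by have := hN (x + s); have := hN x; lra.
rewrite notin_setE /= in_itv/= -ler_norml => /negP; rewrite -ltNge => xN.
rewrite h0 ?h0 ?subrr ?normr0 ?mulr0//; first by lra.
by have := ler_normB (x + s) s; rewrite addrK; lra.
Qed.

Lemma translation_cvg_L1_compactly_supported h N : compactly_supported N h ->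
  (\int[mu]_x `|h (x + s) - h x|%:E)%E @[s --> 0] --> 0%E.
Proof.
move=> /[dup] hN [ch _ _]; pose f s x : R := `|h (x + s) - h x|.
pose g x : R := 2 * N * \1_`[- (N + 1), N + 1]%classic x.
have gi : mu.-integrable setT (EFin \o g).
  exact: integrable_EFinZl (integrable_indic_itv _ _ _ _).
have cf s : continuous (f s).
  move=> x; apply: cvg_norm; apply: cvgB; last exact: ch.
  exact: (@continuous_shift _ h).
have cfx x : continuous (f ^~ x).
  move=> s; apply: cvg_norm; apply: cvgB; last exact: cvg_cst.
  under eq_fun do rewrite addrC; rewrite addrC.
  exact: (@continuous_shift _ h).
have f_le s x : `]-1, 1[%classic s -> `|f s x| <= g x.
  rewrite /= in_itv/= -ltr_norml => s1.
  by rewrite /f normr_id normr_translation_sub_le.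
have fi s : `]-1, 1[%classic s -> mu.-integrable setT (EFin \o f s).
  move=> s1; apply: (le_integrable_EFin _ _ gi); last by move=> x; exact: f_le.
  exact: continuous_measurable_fun.
have cint : {in `]-1, 1[%classic, continuous (fun s => \int[mu]_x f s x)}.
  apply: (continuity_under_integral measurableT fi _ gi).
  - by apply: aeW => x _ s _; exact: cfx.
  - by move=> s s1; apply: aeW => x _; exact: f_le.
have I0 : `]-1, 1[%classic (0 : R) by rewrite /= in_itv/= ltrN10 ltr01.
have f0 : \int[mu]_x f 0 x = 0.
  rewrite /f; under eq_Rintegral do rewrite addr0 subrr normr0.
  by rewrite Rintegral_cst// mul0r.
have := cint 0 (mem_set I0); rewrite /continuous_at f0 => cint0.
apply/fine_cvgP; split => //.
near=> s; apply: (integrable_fin_num measurableT); apply: fi.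
by near: s; apply: (open_nbhs_nbhs (conj _ I0)); exact: itv_open.
Unshelve. all: end_near. Qed.

Lemma translation_cvg_Lp_compactly_supported h N : compactly_supported N h ->
  Lpnorm p (fun x => h (x + s) - h x) @[s --> 0] --> 0%E.
Proof.
move=> /[dup] hcs [ch hN _]; apply/(Lpnorm_powR_cvg0P p1).
have mh := continuous_measurable_fun ch.
have mhs s : measurable_fun setT (fun x : R => h (x + s) - h x).
  by apply: measurable_funB => //; exact: measurable_translation.
pose K := (2 * N) `^ (p - 1).
have Kh_cvg : (K%:E * \int[mu]_x `|h (x + s) - h x|%:E)%E @[s --> 0] --> 0%E.
  rewrite -(mule0 K%:E); apply: cvgeZl => //.
  exact: translation_cvg_L1_compactly_supported hcs.
apply: squeeze_cvge (cvg_cst 0%E) Kh_cvg; apply: nearW => s.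
have m_normr_hs : measurable_fun setT (fun x : R => `|h (x + s) - h x|%:E).
  by apply/measurable_EFinP; exact: measurableT_comp.
rewrite integral_normr_powR_ge0/= -ge0_integralZl_EFin ?powR_ge0//.
apply: ge0_le_integral => //.
- exact: measurable_normr_powR.
- exact: measurable_funeM.
- move=> x _; rewrite -EFinM lee_fin powR_le_linear// normr_ge0/=.
  rewrite (le_trans (ler_normB _ _))//.
  by have := hN (x + s); have := hN x; lra.
Qed.

Lemma Lpnorm_translation f s : measurable_fun setT f ->
  Lpnorm p (fun x => f (x + s)) = Lpnorm p f.
Proof. by move=> mf; rewrite !LpnormE integral_translation_normr_powR. Qed.

Lemma translation_cvg_Lp f : inLp p f ->
  Lpnorm p (fun x => f (x + s) - f x) @[s --> 0] --> 0%E.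
Proof.
move=> /[dup] fLp [mf _]; apply/Lpnorm_cvg0P => e e0.
have e3_gt0 : 0 < e / 3 by rewrite divr_gt0.
have [h [N [hN fh]]] := compactly_supported_dense_Lp fLp e3_gt0.
have [ch _ _] := hN.
have mh := continuous_measurable_fun ch.
have /Lpnorm_cvg0P/(_ _ e3_gt0) := translation_cvg_Lp_compactly_supported hN.
apply: filterS => s hs.
have mfs := measurable_translation s mf.
have mhs := measurable_translation s mh.
apply: le_trans (Lpnorm_triangle p1 mfs mhs mf) _.
have -> : e%:E = ((e / 3)%:E + ((e / 3)%:E + (e / 3)%:E))%E.
  by rewrite -!EFinD; congr EFin; field.
apply: leeD; first by rewrite (Lpnorm_translation s (measurable_funB mf mh)).
apply: le_trans (Lpnorm_triangle p1 mhs mh mf) _.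
by apply: leeD => //; rewrite Lpnorm_distC.
Qed.

Definition Lp_modulus f s : \bar R :=
  (\int[mu]_x (`|f (x - s)%R - f x| `^ p)%:E)%E.

Lemma Lp_modulusE f s :
  Lp_modulus f s = (Lpnorm p (fun x => f (x - s) - f x)%R `^ p)%E.
Proof. by rewrite Lpnorm_poweR. Qed.

Lemma measurable_Lp_modulus f : measurable_fun setT f ->
  measurable_fun setT (Lp_modulus f).
Proof.
move=> mf; pose h (z : measurableTypeR R * measurableTypeR R) :=
  (`|f (z.1 - z.2) - f z.1| `^ p)%:E.
apply: (measurable_fun_fubini_tonelli_G (m1 := mu) h) => [|z].
  apply/measurable_EFinP; apply: (measurableT_comp (measurable_powR p)).
  apply: measurableT_comp => //; apply: measurable_funB.
    by apply: (measurableT_comp mf); exact: measurable_funB.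
  exact: (measurableT_comp mf measurable_fst).
by rewrite lee_fin powR_ge0.
Qed.

Lemma Lp_modulus_bound f : inLp p f ->
  exists M : R, forall s, (0 <= Lp_modulus f s <= M%:E)%E.
Proof.
move=> /[dup] fLp [mf _].
have ffin : ((Lpnorm p f + Lpnorm p f) `^ p)%E \is a fin_num.
  by rewrite fin_num_poweR// fin_numD ge0_fin_numE ?Lpnorm_ge0// Lpnorm_lty.
exists (fine ((Lpnorm p f + Lpnorm p f) `^ p)%E) => s.
rewrite fineK// Lp_modulusE poweR_ge0/=.
have mfs := measurable_translation (- s) mf.
apply: gt0_ler_poweR.
- exact: ltW.
- by rewrite in_itv/= leey Lpnorm_ge0.
- by rewrite in_itv/= leey adde_ge0 ?Lpnorm_ge0.
- by rewrite -{1}(Lpnorm_translation (- s) mf) LpnormB_le.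
Qed.

Lemma Lp_modulus_cvg0 f : inLp p f -> Lp_modulus f s @[s --> 0] --> 0%E.
Proof.
move=> fLp; apply/(Lpnorm_powR_cvg0P p1 _ (fun s x => f (x - s) - f x)).
have cN : - s @[s --> (0 : R)] --> (0 : R).
  by rewrite -[X in _ --> X]oppr0; apply: cvgN; exact: cvg_id.
exact: cvg_comp cN (translation_cvg_Lp fLp).
Qed.

End Lp_translation.

(** * The Poisson integral of an Lp function *)

Section poisson_kernel.
Context {R : realType}.
Local Notation mu := (@lebesgue_measure R).
Implicit Types r s t y : R.

Lemma poisson_gt0 y t : 0 < y -> 0 < poisson y t.
Proof. by move=> y0; rewrite divr_gt0// mulr_gt0 ?pi_gt0// sqrD_sqr_gt0. Qed.

Lemma continuous_poisson y : 0 < y -> continuous (poisson y).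
Proof.
move=> y0 t.
rewrite (_ : poisson y = fun u => - pi^-1 * cauchy_kernel false 1 u y).
  by apply: cvgM; [exact: cvg_cst|exact: continuous_cauchy_kernel].
by apply/funext => u; exact: poissonE.
Qed.

Lemma measurable_poisson y : 0 < y -> measurable_fun setT (poisson y).
Proof.
by move=> y0; apply: continuous_measurable_fun; exact: continuous_poisson.
Qed.

Lemma is_derive_poisson_primitive y t : 0 < y ->
  is_derive t 1 (fun u => pi^-1 * atan (y^-1 * u)) (poisson y t).
Proof.
move=> y0; have dy : is_derive t 1 (fun u => y^-1 * u) (y^-1 * 1).
  exact: is_deriveZ.
have := @is_derive1_comp R (@atan R) _ t _ _ (is_derive1_atan _) dy.
move=> /(is_deriveZ (pi^-1)) /is_derive_eq; apply.
rewrite /poisson /GRing.scale/=; move: (pi_gt0 R); move: (@pi R) => P P0.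
by field; rewrite (gt_eqF P0) (gt_eqF y0) (gt_eqF (sqrD_sqr_gt0 t y0)).
Qed.

Lemma integral_poisson y : 0 < y -> (\int[mu]_t (poisson y t)%:E = 1)%E.
Proof.
move=> y0; rewrite ge0_symfun_integralT; last 3 first.
- by move=> t; exact/ltW/poisson_gt0.
- exact: continuous_poisson.
- by move=> t /=; rewrite poissonN.
have dP t := is_derive_poisson_primitive t y0.
rewrite -set_itvcy (@ge0_continuous_FTC2y _ (poisson y)
   (fun u => pi^-1 * atan (y^-1 * u)) 0 (2%:R^-1)).
- by rewrite mulr0 atan0 mulr0 sube0 -EFinM divff.
- by move=> t _; exact/ltW/poisson_gt0.
- by apply: continuous_subspaceT; exact: continuous_poisson.
- rewrite (_ : 2^-1 = pi^-1 * (pi / 2)); last first.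
    by rewrite mulrA mulVf ?mul1r// gt_eqF// pi_gt0.
  apply: cvgM; first exact: cvg_cst.
  apply: cvg_comp; last exact: cvgy_atan.
  by apply: gt0_cvgMry; rewrite ?invr_gt0//; exact: cvg_id.
- by move=> t _; have [] := dP t.
- by apply: cvg_at_right_filter; exact: is_derive_continuous (dP 0).
- by move=> t _; rewrite derive1E; have [] := dP t.
Qed.

Lemma poisson_density y : 0 < y -> probability_density (poisson y).
Proof.
by move=> y0; split; [exact: measurable_poisson|move=> t; exact/ltW/poisson_gt0|
  exact: integral_poisson].
Qed.

Lemma poisson_tail_le r s y : 0 < r -> 0 < y -> r <= `|s| ->
  poisson y s <= y * (1 + r ^- 2) * poisson 1 s.
Proof.
move=> r0 y0 rs; rewrite /poisson expr1n mul1r -mulrA ler_wpM2l ?(ltW y0)//.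
rewrite ![(pi * _)^-1]invfM mulrCA ler_wpM2l ?invr_ge0 ?pi_ge0//.
have s2 : r ^+ 2 <= s ^+ 2.
  by rewrite -[s ^+ 2]real_normK ?num_real// ler_sqr ?nnegrE// ltW.
have s0 : 0 < s ^+ 2 by apply: lt_le_trans s2; rewrite exprn_gt0.
apply: (@le_trans _ _ (s ^+ 2)^-1).
  by rewrite lef_pV2 ?posrE ?sqrD_sqr_gt0// lerDl sqr_ge0.
rewrite ler_pdivlMr ?ltr_wpDl ?sqr_ge0// ler_pdivrMl// mulrDr mulr1 lerD2l.
by rewrite ler_pdivlMr ?exprn_gt0// mul1r.
Qed.

Section concentration.
Variables (w : R -> \bar R) (M : R).
Hypotheses (mw : measurable_fun setT w) (wM : forall s, (0 <= w s <= M%:E)%E).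

Let w0 s : (0 <= w s)%E. Proof. by have /andP[] := wM s. Qed.

Let M0 : 0 <= M.
Proof. by rewrite -lee_fin; have /andP[/le_trans] := wM 0; apply. Qed.

Let tail_ge0 r : 0 < r -> 0 <= M * (1 + r ^- 2).
Proof.
by move=> r0; rewrite mulr_ge0// addr_ge0// invr_ge0 exprn_ge0// ltW.
Qed.

Let P0 y s : 0 < y -> (0 <= (poisson y s)%:E)%E.
Proof. by move=> y0; rewrite lee_fin ltW// poisson_gt0. Qed.

Let mP y : 0 < y -> measurable_fun setT (fun s => (poisson y s)%:E).
Proof. by move=> y0; apply/measurable_EFinP; exact: measurable_poisson. Qed.

Lemma poisson_mule_le (e r y s : R) : 0 <= e -> 0 < r -> 0 < y ->
  (forall t, `|t| < r -> (w t <= e%:E)%E) ->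
  ((poisson y s)%:E * w s <=
   e%:E * (poisson y s)%:E + (M * (1 + r ^- 2) * y)%:E * (poisson 1 s)%:E)%E.
Proof.
move=> e0 r0 y0 we; have c0 := mulr_ge0 (tail_ge0 r0) (ltW y0).
have [sr|rs] := ltP `|s| r.
  rewrite muleC (@le_trans _ _ (e%:E * (poisson y s)%:E)%E)//.
    by rewrite lee_wpmul2r ?P0// we.
  by rewrite leeDl// mule_ge0 ?P0.
rewrite (@le_trans _ _ ((poisson y s)%:E * M%:E)%E)//.
  by rewrite lee_wpmul2l ?P0//; have /andP[] := wM s.
rewrite (@le_trans _ _ ((M * (1 + r ^- 2) * y)%:E * (poisson 1 s)%:E)%E)//.
  rewrite -!EFinM lee_fin.
  by have := ler_wpM2r M0 (poisson_tail_le r0 y0 rs); lra.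
by rewrite leeDr// mule_ge0 ?P0.
Qed.

Lemma poisson_integral_le (e r y : R) : 0 <= e -> 0 < r -> 0 < y ->
  (forall t, `|t| < r -> (w t <= e%:E)%E) ->
  (\int[mu]_s ((poisson y s)%:E * w s) <= (e + M * (1 + r ^- 2) * y)%:E)%E.
Proof.
move=> e0 r0 y0 we; have c0 := mulr_ge0 (tail_ge0 r0) (ltW y0).
have -> : (e + M * (1 + r ^- 2) * y)%:E = (\int[mu]_s
    (e%:E * (poisson y s)%:E + (M * (1 + r ^- 2) * y)%:E * (poisson 1 s)%:E))%E.
  rewrite ge0_integralD//; last 4 first.
  - by move=> s _; rewrite mule_ge0 ?P0.
  - by apply: measurable_funeM; exact: mP.
  - by move=> s _; rewrite mule_ge0 ?P0.
  - by apply: measurable_funeM; exact: mP.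
  rewrite !ge0_integralZl_EFin//; try exact: mP; try by move=> s _; exact: P0.
  by rewrite !integral_poisson// !mule1 EFinD.
apply: ge0_le_integral => //.
- by move=> s _; rewrite mule_ge0 ?P0.
- by apply: emeasurable_funM => //; exact: mP.
- by apply: emeasurable_funD; apply: measurable_funeM; exact: mP.
- by move=> s _; exact: poisson_mule_le.
Qed.

Lemma poisson_integral_cvg0 : w s @[s --> 0] --> 0%E ->
  (\int[mu]_s ((poisson y s)%:E * w s))%E @[y --> 0^'+] --> 0%E.
Proof.
move=> /ge0_cvge0P-/(_ (nearW _ w0)) w_near0; apply/ge0_cvge0P => [|e e0].
  near=> y; apply: integral_ge0 => s _; apply: mule_ge0 => //; apply: P0.
  by near: y; exact: nbhs_right_gt.
have e2_gt0 : 0 < e / 2 by rewrite divr_gt0.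
have /nbhs_ballP[r /= r0 w_ball] := w_near0 _ e2_gt0.
pose c := M * (1 + r ^- 2); have c0 : 0 <= c := tail_ge0 r0.
near=> y.
have y0 : 0 < y by near: y; exact: nbhs_right_gt.
have cy_le : y <= e / 2 / (c + 1).
  by near: y; apply: nbhs_right_le; rewrite divr_gt0// ltr_wpDl.
apply: (le_trans (poisson_integral_le (ltW e2_gt0) r0 y0 _)).
  by move=> t tr; apply: w_ball; rewrite /ball/= sub0r normrN.
rewrite lee_fin [leRHS]splitr lerD2l -/c.
by move: cy_le; rewrite ler_pdivlMr ?ltr_wpDl// => ?; nra.
Unshelve. all: end_near. Qed.

End concentration.

End poisson_kernel.

Section Lp_poisson.
Context {R : realType} (p : R).
Local Notation mu := (@lebesgue_measure R).
Hypothesis p1 : 1 <= p.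
Implicit Types (F : R -> R) (x y : R).

Lemma inLp_weighted_integrable F : inLp p F -> weighted_integrable F.
Proof.
move=> /[dup] LF [mF _]; split => //.
have Fpi := inLp_integrable_powR LF.
apply: (le_integrable_EFin _ _ (integrable_EFinD integrable_oneDsqrV Fpi)).
  apply: measurable_funM; first exact: measurableT_comp.
  exact: measurable_oneDsqrV.
move=> x; rewrite ger0_norm ?divr_ge0//.
have [F1|/ltW F1] := leP `|F x| 1.
  by rewrite (le_trans (ler_piMl _ F1))// ?invr_ge0// lerDl powR_ge0.
rewrite ler_wpDl ?invr_ge0// (@le_trans _ _ `|F x|)//.
  by rewrite ler_piMr// oneDsqrV_le1.
by rewrite -{1}[`|F x|]powRr1// ler_powR.
Qed.

Lemma integrable_poisson_convolution F y : weighted_integrable F -> 0 < y ->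
  forall x, mu.-integrable setT (EFin \o (fun t => F t * poisson y (x - t))).
Proof.
move=> wF y0 x.
have := integrable_EFinZl (- pi^-1)
  (integrable_cauchy_integrand x wF (isT : (false < 1)%N) y0).
congr integrable; apply/funext => t /=; congr EFin.
by rewrite -poissonN opprB poissonE mulrCA.
Qed.

Lemma Lp_poissonU_le F y : inLp p F -> 0 < y ->
  (\int[mu]_x (`|poissonU F y x| `^ p)%:E <= \int[mu]_x (`|F x| `^ p)%:E)%E.
Proof.
move=> /[dup] LF [mF _] y0.
apply: (Lp_convolution_le p1 (poisson_density y0) mF).
exact: integrable_poisson_convolution (inLp_weighted_integrable LF) y0.
Qed.

Lemma inLp_poissonU F y : inLp p F -> 0 < y -> inLp p (poissonU F y).
Proof.
move=> /[dup] LF [mF iF] y0; split.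
  exact: measurable_convolution mF (measurable_poisson y0).
exact: le_lt_trans (Lp_poissonU_le LF y0) iF.
Qed.

Lemma Lpnorm_poissonU_cvg F : inLp p F ->
  Lpnorm p (fun x => poissonU F y x - F x) @[y --> 0^'+] --> 0%E.
Proof.
move=> /[dup] LF [mF _]; apply/(Lpnorm_powR_cvg0P p1).
have [M ModM] := Lp_modulus_bound p1 LF.
have mMod := measurable_Lp_modulus p mF.
apply: squeeze_cvge (cvg_cst 0%E)
  (poisson_integral_cvg0 mMod ModM (Lp_modulus_cvg0 p1 LF)).
near=> y; have y0 : 0 < y by near: y; exact: nbhs_right_gt.
rewrite integral_normr_powR_ge0/=.
apply: (Lp_convolution_sub_le p1 (poisson_density y0) mF mF).
exact: integrable_poisson_convolution (inLp_weighted_integrable LF) y0.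
Unshelve. all: end_near. Qed.

End Lp_poisson.

Theorem mainTheorem18 (R : realType) (p : R) (n : nat) (F : R -> R) :
  1 <= p -> inLp p F ->
  (* (a) *)
  (forall x y : R, 0 < y ->
     (@lebesgue_measure R).-integrable setT (EFin \o poisson_integrand n F y x) /\
     (forall k : nat, (k < n)%N -> forall t : R,
        derivable (derive1n k (poissonU F y)) t 1) /\
     poissonu n F y x = derive1n n (poissonU F y) x) /\
  (* (b) *)
  harmonic_on (@upper_half_plane R) (fun z => poissonu n F z.2 z.1) /\
  (* (c) *)
  (forall y : R, 0 < y ->
     inLp p (poissonU F y) /\
     is_nth_distr_deriv n (poissonu n F y) (poissonU F y) /\
     (Lpnorm p (poissonU F y) <= Lpnorm p F)%E) /\
  (* (d) *)
  (Lpnorm p (fun x => poissonU F y x - F x) @[y --> 0^'+] --> 0%E).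
Proof.
move=> p1 LF; have wF := inLp_weighted_integrable p1 LF.
split; [|split; [|split]].
- move=> x y y0; split; first exact: integrable_poisson_integrand.
  split; last by rewrite derive1n_poissonU.
  by move=> k _ t; exact: derivable_derive1n_poissonU.
- apply: (harmonic_cauchy_integral wF (ltn0Sn n : (false < n.+1)%N)) => z z0.
  exact: poissonuE.
- move=> y y0; split; first exact: inLp_poissonU.
  split; last exact: le_Lpnorm (Lp_poissonU_le p1 LF y0).
  rewrite -derive1n_poissonU//; apply: is_nth_distr_deriv_derive1n.
  exact: slowly_increasing_poissonU.
- exact: Lpnorm_poissonU_cvg.
Qed.
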